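(* Let $\sigma$ be a root of $\mathcal P(\sigma;\delta,\nu)=0$. (i) If $\mathcal P'(\sigma;\delta,\nu)<0$, the solution $(\rho_*,\psi_* )$ of (MS) with asymptotics of type (E1) is unstable. (ii) If $\mathcal P'(\sigma;\delta,\nu)=0$ and $\mathcal P''(\sigma;\delta,\nu)<0$, the solution $(\rho_*,\psi_* )$ of (MS) with asymptotics of type (E2) with $\psi_1=\phi$ (i.e. $\psi_*(\tau)=\sigma+\phi\tau^{-1/4}+O(\tau^{-1/2})$) is unstable. (iii) If $\mathcal P'(\sigma;\delta,\nu)=\mathcal P''(\sigma;\delta,\nu)=0$ and $\mathcal P'''(\sigma;\delta,\nu)<0$, the solution $(\rho_*,\psi_* )$ of (MS) with asymptotics of type (E3) is unstable.
   Context: Let $\lambda>0$, $\nu\in[0,\pi)$, and let $\mu:[0,\infty)\to\mathbb R$ be a smooth function with asymptotic expansion $\mu(\tau)=\tau^{-1/2}\big(\mu_0+\sum_{k\ge1}\mu_k\tau^{-k}\big)$ as $\tau\to\infty$, with constants $\mu_k$. System (MS) for unknown functions $\rho(\tau),\psi(\tau)$, $\tau\ge0$, is $\frac{d\rho}{d\tau}+\mu(\tau)\rho\sin(2\psi+\nu)=\sin\psi$, $\quad\rho\big[\frac{d\psi}{d\tau}-\rho^2+\lambda\tau\big]+\mu(\tau)\rho\cos(2\psi+\nu)=\cos\psi$. Set $\delta:=\mu_0\sqrt\lambda$ and $\mathcal P(\sigma;\delta,\nu):=\delta\sin(2\sigma+\nu)-\sin\sigma$; primes on $\mathcal P$ denote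 derivatives in $\sigma$. Asymptotic expansion types (asymptotic series with constant coefficients as $\tau\to\infty$, $\sigma$ a root of $\mathcal P(\cdot;\delta,\nu)=0$): (E1) $\rho(\tau)\sim\sqrt\lambda\,\tau^{1/2}+\sum_{k\ge1}\rho_k\tau^{-k/2}$, $\psi(\tau)\sim\sigma+\sum_{k\ge1}\psi_k\tau^{-k/2}$ (here $\mathcal P'(\sigma;\delta,\nu)\ne0$, $\rho_1=0$, $\psi_1=-\sqrt\lambda/(2\mathcal P'(\sigma;\delta,\nu))$); (E2) $\rho(\tau)\sim\sqrt\lambda\,\tau^{1/2}+\sum_{k\ge2}\rho_k\tau^{-k/4}$, $\psi(\tau)\sim\sigma+\sum_{k\ge1}\psi_k\tau^{-k/4}$ with $\psi_1\in\{\phi,-\phi\}$, where $\phi:=\sqrt{-\sqrt\lambda/\mathcal P''(\sigma;\delta,\nu)}$ (requires $\mathcal P''(\sigma;\delta,\nu)<0$); (E3) $\rho(\tau)\sim\sqrt\lambda\,\tau^{1/2}+\sum_{k\ge2}\rho_k\tau^{-k/6}$, $\psi(\tau)\sim\sigma+\sum_{k\ge1}\psi_k\tau^{-k/6}$ with $\psi_1=-\chi$, $\chi:=\big(3\sqrt\lambda/\mathcal P'''(\sigma;\delta,\nu)\big)^{1/3}$. Stability is in the sense of Lyapunov: a solution $(\rho_*,\psi_* )$ of (MS) defined on $[0,\infty)$ is stable if for every $\varepsilon>0$ there is $\eta>0$ such that every solution with $|\rho(0)-\rho_*(0)|+|\psi(0)-\psi_*(0)|<\eta$ exists for all $\tau\ge0$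 and satisfies $|\rho(\tau)-\rho_*(\tau)|+|\psi(\tau)-\psi_*(\tau)|<\varepsilon$ for all $\tau\ge0$; it is unstable otherwise. *)

(* Defs.v *)
From Stdlib Require Import Reals Lra.
Open Scope R_scope.

(* P(s;delta,nu) = delta sin(2s+nu) - sin s and its s-derivatives
   (computed in closed form). *)
Definition Pf (s delta nu : R) : R := delta * sin (2 * s + nu) - sin s.
Definition Pf1 (s delta nu : R) : R := 2 * delta * cos (2 * s + nu) - cos s.
Definition Pf2 (s delta nu : R) : R := - (4 * delta * sin (2 * s + nu)) + sin s.
Definition Pf3 (s delta nu : R) : R := - (8 * delta * cos (2 * s + nu)) + cos s.

Definition cbrt (x : R) : R :=
  match Rcase_abs x with
  | left _ => - Rpower (- x) (1/3)
  | right _ => if Req_EM_T x 0 then 0 else Rpower x (1/3)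
  end.

Fixpoint psum (c : nat -> R) (e q t : R) (N : nat) : R :=
  match N with
  | O => 0
  | S n => psum c e q t n + c (S n) * Rpower t (e - INR (S n) * q)
  end.

Definition asymp (f lead : R -> R) (e : R) (c : nat -> R) (q : R) : Prop :=
  forall N : nat, exists C M : R, 0 < M /\
    forall t, M <= t ->
      Rabs (f t - lead t - psum c e q t N) <= C * Rpower t (e - INR (S N) * q).

(* mu : [0,oo) -> R smooth: restriction to [0,oo) of a C^oo function on R *)
Definition smooth_on_halfline (mu : R -> R) : Prop :=
  exists D : nat -> R -> R,
    (forall t, 0 <= t -> D O t = mu t) /\
    (forall n t, derivable_pt_lim (D n) t (D (S n) t)).

Definition mu_expansion (mu : R -> R) (muc : nat -> R) : Prop :=
  asymp mu (fun t => muc O * Rpower t (-(1/2))) (-(1/2)) muc 1.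

Definition in_I (T : option R) (t : R) : Prop :=
  0 <= t /\ match T with None => True | Some b => t < b end.

Definition MS_sol (lam nu : R) (mu : R -> R) (T : option R)
    (rho psi : R -> R) : Prop :=
  match T with None => True | Some b => 0 < b end /\
  (forall t, in_I T t -> 0 < t ->
     exists drho dpsi,
       derivable_pt_lim rho t drho /\ derivable_pt_lim psi t dpsi /\
       drho + mu t * rho t * sin (2 * psi t + nu) = sin (psi t) /\
       rho t * (dpsi - (rho t)^2 + lam * t) + mu t * rho t * cos (2 * psi t + nu)
         = cos (psi t)) /\
  (forall eps, 0 < eps -> exists d, 0 < d /\ forall t, in_I T t -> t < d ->
     Rabs (rho t - rho 0) < eps /\ Rabs (psi t - psi 0) < eps).

Definition lyap_stable (lam nu : R) (mu : R -> R) (rs ps : R -> R) : Prop :=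
  forall eps, 0 < eps -> exists eta, 0 < eta /\
    forall r0 p0, Rabs (r0 - rs 0) + Rabs (p0 - ps 0) < eta ->
      (exists rho psi, MS_sol lam nu mu None rho psi /\ rho 0 = r0 /\ psi 0 = p0) /\
      (forall T rho psi, MS_sol lam nu mu T rho psi -> rho 0 = r0 -> psi 0 = p0 ->
         forall t, in_I T t -> Rabs (rho t - rs t) + Rabs (psi t - ps t) < eps).

Definition lyap_unstable lam nu mu rs ps : Prop := ~ lyap_stable lam nu mu rs ps.

Definition typeE1 (lam delta nu sigma : R) (rs ps : R -> R) : Prop :=
  exists rc pc : nat -> R,
    rc 1%nat = 0 /\ pc 1%nat = - sqrt lam / (2 * Pf1 sigma delta nu) /\
    asymp rs (fun t => sqrt lam * Rpower t (1/2)) 0 rc (1/2) /\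
    asymp ps (fun _ => sigma) 0 pc (1/2).

(* E2 with psi_1 = phi  (rho series starts at k = 2: rho_1 = 0) *)
Definition typeE2_plus (lam delta nu sigma : R) (rs ps : R -> R) : Prop :=
  exists rc pc : nat -> R,
    rc 1%nat = 0 /\ pc 1%nat = sqrt (- sqrt lam / Pf2 sigma delta nu) /\
    asymp rs (fun t => sqrt lam * Rpower t (1/2)) 0 rc (1/4) /\
    asymp ps (fun _ => sigma) 0 pc (1/4).

Definition typeE3 (lam delta nu sigma : R) (rs ps : R -> R) : Prop :=
  exists rc pc : nat -> R,
    rc 1%nat = 0 /\ pc 1%nat = - cbrt (3 * sqrt lam / Pf3 sigma delta nu) /\
    asymp rs (fun t => sqrt lam * Rpower t (1/2)) 0 rc (1/6) /\
    asymp ps (fun _ => sigma) 0 pc (1/6).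

(* Main.v *)
(** If the solution were stable, every nearby initial point would start a
    solution that stays close to it.  In the variable [z = rho exp(i psi)] the
    system becomes a cubic polynomial equation, free of the singularity at
    [rho = 0], so the map from initial data to the state at a fixed time [T] is
    bi-Lipschitz and, to second order, odd around the given solution.  By the
    intermediate value theorem some antipodal pair on a small circle of initial
    data is sent at time [T] to two states whose difference points along the
    diagonal, and oddness puts one of them in the open quadrant
    [rho > rs, psi > ps].  In that quadrant
    [d/dt ((rho - rs) (psi - ps)) >= k (rho - rs) (psi - ps)] with [k > 0],
    because [psi - ps] is driven by [2 rs (rho - rs)] with [rs ~ sqrt (lam t)]
    and [rho - rs] by [- Pf1 * (psi - ps)], where [- Pf1 >> t^(-1/2)] above [ps]
    in each of the three cases.  So the distance cannot stay bounded.  If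
    [rs 0 = 0] the circle degenerates, but then stability fails already because
    no solution starts at [rho = 0] with [cos psi <> 0]. *)

Require Import Defs.
From Stdlib Require Import Reals Lra Psatz Classical IndefiniteDescription.
Open Scope R_scope.

(** The growth estimate is available only at late times [t >= T], whereas stability speaks of data
    at time 0. On the way [rho] may vanish, and there the polar equations do not determine the
    angular velocity; hence the passage from 0 to [T] in Cartesian coordinates. Prescribing a point
    of the quadrant at [T] and solving backwards would call for an existence theory. Only forward
    solutions granted by the stability assumption are used instead; they are merely selected, and
    uniqueness and continuous dependence come from Gronwall bounds on squared distances. A
    displacement of arbitrary sign would not do: near a degenerate root with [Pf2 < 0], [Pf1] is
    negative only above [sigma], so expansion on a neighbourhood of fixed size is guaranteed only
    for [psi > ps]. This is why oddness has to be exploited to second order. The slope is measured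
    against [t^(-1/2)] because replacing [mu * rs] by its limit [delta] costs [O(t^(-1/2))]; so
    [- sqrt t * Pf1] has to beat a constant. *)

(* Continuity on [0,oo), encoded through the constant extension to the left, so
   that the two-sided continuity lemmas apply. *)
Definition cont_halfline (f : R -> R) : Prop := continuity (fun t => f (Rmax 0 t)).

Lemma cont_halfline_plus f g :
  cont_halfline f -> cont_halfline g -> cont_halfline (fun t => f t + g t).
Proof. intros Hf Hg t; exact (continuity_pt_plus _ _ t (Hf t) (Hg t)). Qed.

Lemma cont_halfline_minus f g :
  cont_halfline f -> cont_halfline g -> cont_halfline (fun t => f t - g t).
Proof. intros Hf Hg t; exact (continuity_pt_minus _ _ t (Hf t) (Hg t)). Qed.

Lemma cont_halfline_mult f g :
  cont_halfline f -> cont_halfline g -> cont_halfline (fun t => f t * g t).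
Proof. intros Hf Hg t; exact (continuity_pt_mult _ _ t (Hf t) (Hg t)). Qed.

Lemma cont_halfline_comp f g :
  cont_halfline f -> continuity g -> cont_halfline (fun t => g (f t)).
Proof. intros Hf Hg t; exact (continuity_pt_comp _ g t (Hf t) (Hg _)). Qed.

Lemma continuous_cont_halfline f : continuity f -> cont_halfline f.
Proof.
  intros Hf t. apply (continuity_pt_comp (Rmax 0) f); [|apply Hf].
  intros eps He. exists eps; split; [exact He|]. intros y [_ Hy].
  unfold dist, R_met, R_dist in *. simpl in *. unfold Rdist in *.
  apply Rle_lt_trans with (2 := Hy). unfold Rmax.
  destruct (Rle_dec 0 y), (Rle_dec 0 t); unfold Rabs;
    repeat destruct Rcase_abs; lra.
Qed.

Lemma cont_halfline_ext f g :
  (forall t, 0 <= t -> f t = g t) -> cont_halfline f -> cont_halfline g.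
Proof.
  intros E Hf t eps He. destruct (Hf t eps He) as [d [Hd H]].
  exists d; split; [exact Hd|]. intros y Hy.
  rewrite <- !E by apply Rmax_l. exact (H y Hy).
Qed.

(** The two hypotheses have the shape in which [MS_sol] supplies regularity: differentiability at
    positive times and one-sided continuity at 0. *)
Lemma cont_halfline_intro f :
  (forall t, 0 < t -> continuity_pt f t) ->
  (forall eps, 0 < eps -> exists d, 0 < d /\
     forall t, 0 <= t -> t < d -> Rabs (f t - f 0) < eps) ->
  cont_halfline f.
Proof.
  intros Hp H0 t. destruct (Rlt_le_dec 0 t) as [Ht|Ht]; intros eps He.
  - destruct (Hp t Ht eps He) as [d [Hd H]].
    exists (Rmin d t); split; [apply Rmin_glb_lt; lra|].
    intros y [Dy Hy]. simpl in *. unfold Rdist in *.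
    pose proof (Rmin_l d t). pose proof (Rmin_r d t).
    assert (0 < y) by (apply Rabs_def2 in Hy; lra).
    rewrite !Rmax_right by lra. apply H; split; [exact Dy|]. simpl. unfold Rdist. lra.
  - destruct (H0 eps He) as [d [Hd H]]. exists d; split; [exact Hd|].
    intros y [_ Hy]. simpl in *. unfold Rdist in *.
    rewrite (Rmax_left 0 t) by lra. apply H; [apply Rmax_l|].
    apply Rabs_def2 in Hy. apply Rmax_lub_lt; lra.
Qed.

Lemma cont_halfline_pos_pt f t : cont_halfline f -> 0 < t -> continuity_pt f t.
Proof.
  intros Hf Ht eps He. destruct (Hf t eps He) as [d [Hd H]].
  exists (Rmin d t); split; [apply Rmin_glb_lt; lra|].
  intros y [Dy Hy]. specialize (H y). simpl in *. unfold Rdist in *.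
  pose proof (Rmin_l d t). pose proof (Rmin_r d t).
  assert (0 < y) by (apply Rabs_def2 in Hy; lra).
  rewrite !Rmax_right in H by lra. apply H. split; [exact Dy|lra].
Qed.

Lemma cont_halfline_near0 f eps :
  cont_halfline f -> 0 < eps ->
  exists d, 0 < d /\ forall t, 0 <= t < d -> Rabs (f t - f 0) < eps.
Proof.
  intros Hf He. destruct (Hf 0 eps He) as [d [Hd H]].
  exists d; split; [exact Hd|]. intros t Ht.
  destruct (Req_dec t 0) as [->|N].
  { unfold Rminus; rewrite Rplus_opp_r, Rabs_R0; exact He. }
  specialize (H t). simpl in H. unfold Rdist in H.
  rewrite !Rmax_right in H by lra. apply H.
  split; [split; [exact I|lra]|]. rewrite Rabs_pos_eq; lra.
Qed.

Lemma cont_halfline_bounded f T :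
  cont_halfline f -> 0 <= T -> exists B, 0 < B /\ forall t, 0 <= t <= T -> Rabs (f t) <= B.
Proof.
  intros Hf HT.
  assert (C : continuity (fun t => Rabs (f (Rmax 0 t)))).
  { intros t. apply (continuity_pt_comp _ Rabs); [apply Hf|apply Rcontinuity_abs]. }
  destruct (continuity_ab_maj (fun t => Rabs (f (Rmax 0 t))) 0 T HT) as [m [Hm _]].
  { intros c _; apply C. }
  exists (Rabs (f (Rmax 0 m)) + 1). split.
  { pose proof (Rabs_pos (f (Rmax 0 m))); lra. }
  intros t Ht. specialize (Hm t Ht). simpl in Hm.
  rewrite (Rmax_right 0 t) in Hm by lra. lra.
Qed.

(** The derivative is asked for in the open interval only, so [a = 0] is allowed although the system
    says nothing about derivatives at time 0. *)
Lemma mvt_halfline f f' a b :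
  cont_halfline f -> 0 <= a < b ->
  (forall t, a < t < b -> derivable_pt_lim f t (f' t)) ->
  exists c, a < c < b /\ f b - f a = f' c * (b - a).
Proof.
  intros Hf Hab Hd.
  set (g := fun t => f (Rmax 0 t)).
  assert (D : forall c, a < c < b -> derivable_pt_lim g c (f' c)).
  { intros c Hc eps He. destruct (Hd c Hc eps He) as [[d Hdp] H].
    assert (Hm : 0 < Rmin d c) by (apply Rmin_glb_lt; lra).
    exists (mkposreal _ Hm). intros h Nh Hh. simpl in Hh.
    pose proof (Rmin_l d c). pose proof (Rmin_r d c).
    pose proof (Rabs_def2 _ _ Hh). unfold g. rewrite !Rmax_right by lra.
    apply H; simpl; [exact Nh|lra]. }
  destruct (MVT g id a b (fun c Hc => exist _ (f' c) (D c Hc))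
              (fun c _ => derivable_pt_id c)) as [c [Hc E]].
  - lra.
  - intros c _; apply Hf.
  - intros c _; apply derivable_continuous, derivable_id.
  - exists c; split; [exact Hc|]. revert E. rewrite derive_pt_id. simpl.
    unfold g, id. rewrite !Rmax_right by lra. lra.
Qed.

(** * Gronwall inequalities *)

Lemma derivable_pt_lim_linear k t : derivable_pt_lim (fun s => k * s) t k.
Proof.
  pose proof (derivable_pt_lim_scal id k t 1 (derivable_pt_lim_id t)) as H.
  rewrite Rmult_1_r in H. exact H.
Qed.

Lemma derivable_pt_lim_exp_linear k t :
  derivable_pt_lim (fun s => exp (k * s)) t (exp (k * t) * k).
Proof.
  apply (derivable_pt_lim_comp (fun s => k * s) exp);
    [apply derivable_pt_lim_linear|apply derivable_pt_lim_exp].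
Qed.

Lemma gronwall_upper E E' K M T :
  cont_halfline E -> 0 <= T -> 0 <= K -> 0 <= M ->
  (forall t, 0 < t -> t <= T -> derivable_pt_lim E t (E' t)) ->
  (forall t, 0 < t -> t <= T -> E' t <= K * E t + M) ->
  E T <= (E 0 + M * T) * exp (K * T).
Proof.
  intros HE HT HK HM HD HB.
  destruct (Req_dec T 0) as [->|NT].
  { rewrite !Rmult_0_r, exp_0. lra. }
  (* [F] is nonincreasing: the weight removes [K * E], and the forcing that remains is at most
     [M * exp (- K * t) <= M], which the term [M * t] compensates. *)
  set (F := fun t => E t * exp (- K * t) - M * t).
  set (F' := fun t => E' t * exp (- K * t) + E t * (exp (- K * t) * - K) - M).
  destruct (mvt_halfline F F' 0 T) as [c [Hc H]].
  - apply cont_halfline_minus; [apply cont_halfline_mult; [exact HE|]|];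
      apply continuous_cont_halfline; reg.
  - lra.
  - intros t Ht.
    apply (derivable_pt_lim_minus (fun s => E s * exp (- K * s)) (fun s => M * s));
      [|apply derivable_pt_lim_linear].
    apply (derivable_pt_lim_mult E (fun s => exp (- K * s)));
      [apply HD; lra|apply derivable_pt_lim_exp_linear].
  - assert (L : F' c <= 0).
    { unfold F'. specialize (HB c). pose proof (exp_pos (- K * c)) as P.
      assert (exp (- K * c) <= 1).
      { rewrite <- exp_0. destruct (Req_dec K 0) as [->|].
        - right; f_equal; ring.
        - left; apply exp_increasing. nra. }
      assert (E' c - K * E c <= M) by (assert (E' c <= K * E c + M) by (apply HB; lra); lra).
      nra. }
    assert (F T <= F 0) by nra.
    unfold F in *. replace (- K * 0) with 0 in * by ring. rewrite exp_0 in *.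
    assert (X : exp (- K * T) * exp (K * T) = 1).
    { rewrite <- exp_plus, <- exp_0. f_equal; ring. }
    pose proof (exp_pos (K * T)).
    replace (E T) with (E T * exp (- K * T) * exp (K * T)) by (rewrite Rmult_assoc, X; ring).
    apply Rmult_le_compat_r; lra.
Qed.

Lemma gronwall_lower E E' K T :
  cont_halfline E -> 0 <= T ->
  (forall t, 0 < t -> t <= T -> derivable_pt_lim E t (E' t)) ->
  (forall t, 0 < t -> t <= T -> - K * E t <= E' t) ->
  E 0 <= E T * exp (K * T).
Proof.
  intros HE HT HD HB.
  destruct (Req_dec T 0) as [->|NT].
  { rewrite !Rmult_0_r, exp_0. lra. }
  set (F := fun t => E t * exp (K * t)).
  set (F' := fun t => E' t * exp (K * t) + E t * (exp (K * t) * K)).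
  destruct (mvt_halfline F F' 0 T) as [c [Hc H]].
  - apply cont_halfline_mult; [exact HE|apply continuous_cont_halfline; reg].
  - lra.
  - intros t Ht. apply (derivable_pt_lim_mult E (fun s => exp (K * s)));
      [apply HD; lra|apply derivable_pt_lim_exp_linear].
  - assert (L : 0 <= F' c).
    { unfold F'. pose proof (exp_pos (K * c)) as P.
      assert (- K * E c <= E' c) by (apply HB; lra). nra. }
    assert (F 0 <= F T) by nra.
    unfold F in *. replace (K * 0) with 0 in * by ring. rewrite exp_0 in *. lra.
Qed.

(** * Cartesian form of the system *)

(* The components of the field [i + i (|z|^2 - lam t) z - i m exp(- i nu) conj z]
   that governs [z = rho exp(i psi)]. *)
Definition vx (lam nu m t x y : R) : R :=
  - (x ^ 2 + y ^ 2 - lam * t) * y - m * (y * cos nu + x * sin nu).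
Definition vy (lam nu m t x y : R) : R :=
  1 + (x ^ 2 + y ^ 2 - lam * t) * x - m * (x * cos nu - y * sin nu).

Definition cart_sol (lam nu : R) (mu x y : R -> R) : Prop :=
  cont_halfline x /\ cont_halfline y /\
  forall t, 0 < t ->
    derivable_pt_lim x t (vx lam nu (mu t) t (x t) (y t)) /\
    derivable_pt_lim y t (vy lam nu (mu t) t (x t) (y t)).

Lemma MS_sol_cont lam nu mu rho psi :
  MS_sol lam nu mu None rho psi -> cont_halfline rho /\ cont_halfline psi.
Proof.
  intros [_ [HD H0]]. split; apply cont_halfline_intro.
  - intros t Ht. destruct (HD t) as [a [b [Ha _]]]; [split; [lra|exact I]|exact Ht|].
    apply derivable_continuous_pt. exists a; exact Ha.
  - intros eps He. destruct (H0 eps He) as [d [Hd H]]. exists d; split; [exact Hd|].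
    intros t Ht Htd. apply H; [split; [exact Ht|exact I]|exact Htd].
  - intros t Ht. destruct (HD t) as [a [b [_ [Hb _]]]]; [split; [lra|exact I]|exact Ht|].
    apply derivable_continuous_pt. exists b; exact Hb.
  - intros eps He. destruct (H0 eps He) as [d [Hd H]]. exists d; split; [exact Hd|].
    intros t Ht Htd. apply H; [split; [exact Ht|exact I]|exact Htd].
Qed.

(** The second equation enters only through the product [rho * psi'], which is exactly what the
    Cartesian derivatives contain. Nothing is divided by [rho], so the statement survives zeros of
    [rho]. *)
Lemma MS_cart lam nu mu rho psi :
  MS_sol lam nu mu None rho psi ->
  cart_sol lam nu mu (fun t => rho t * cos (psi t)) (fun t => rho t * sin (psi t)).
Proof.
  intros HS. destruct (MS_sol_cont _ _ _ _ _ HS) as [Cr Cp].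
  split; [|split].
  - apply cont_halfline_mult; [exact Cr|].
    apply (cont_halfline_comp psi cos); [exact Cp|apply continuity_cos].
  - apply cont_halfline_mult; [exact Cr|].
    apply (cont_halfline_comp psi sin); [exact Cp|apply continuity_sin].
  - intros t Ht. destruct HS as [_ [HD _]].
    destruct (HD t) as [a [b [Ha [Hb [E1 E2]]]]]; [split; [lra|exact I]|exact Ht|].
    assert (Ea : a = sin (psi t) - mu t * rho t * sin (2 * psi t + nu)) by lra.
    assert (Eb : rho t * b = cos (psi t) - mu t * rho t * cos (2 * psi t + nu)
                             + rho t * (rho t ^ 2 - lam * t)) by lra.
    (* Turning the angle [2 psi + nu] back by [psi] leaves [psi + nu]; this is how the forcing
       becomes the conjugate-linear term of the field. *)
    assert (T1 : sin (2 * psi t + nu) * cos (psi t) - cos (2 * psi t + nu) * sin (psi t)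
                 = sin (psi t) * cos nu + cos (psi t) * sin nu).
    { rewrite <- sin_minus, <- sin_plus. f_equal; ring. }
    assert (T2 : cos (2 * psi t + nu) * cos (psi t) + sin (2 * psi t + nu) * sin (psi t)
                 = cos (psi t) * cos nu - sin (psi t) * sin nu).
    { rewrite <- cos_minus, <- cos_plus. f_equal; ring. }
    pose proof (sin2_cos2 (psi t)) as SC. unfold Rsqr in SC.
    assert (N : (rho t * cos (psi t)) ^ 2 + (rho t * sin (psi t)) ^ 2 = rho t ^ 2).
    { transitivity (rho t ^ 2 * (sin (psi t) * sin (psi t) + cos (psi t) * cos (psi t)));
        [ring|rewrite SC; ring]. }
    unfold vx, vy. rewrite N. split.
    + replace (- (rho t ^ 2 - lam * t) * (rho t * sin (psi t)) -
        mu t * (rho t * sin (psi t) * cos nu + rho t * cos (psi t) * sin nu))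
        with (a * cos (psi t) + rho t * (- sin (psi t) * b)).
      * apply (derivable_pt_lim_mult rho (fun t => cos (psi t))); [exact Ha|].
        apply (derivable_pt_lim_comp psi cos); [exact Hb|apply derivable_pt_lim_cos].
      * transitivity (a * cos (psi t) - sin (psi t) * (rho t * b)); [ring|].
        rewrite Ea, Eb.
        replace (mu t * (rho t * sin (psi t) * cos nu + rho t * cos (psi t) * sin nu))
          with (mu t * rho t * (sin (psi t) * cos nu + cos (psi t) * sin nu)) by ring.
        rewrite <- T1. ring.
    + replace (1 + (rho t ^ 2 - lam * t) * (rho t * cos (psi t)) -
        mu t * (rho t * cos (psi t) * cos nu - rho t * sin (psi t) * sin nu))
        with (a * sin (psi t) + rho t * (cos (psi t) * b)).
      * apply (derivable_pt_lim_mult rho (fun t => sin (psi t))); [exact Ha|].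
        apply (derivable_pt_lim_comp psi sin); [exact Hb|apply derivable_pt_lim_sin].
      * transitivity (a * sin (psi t) + cos (psi t) * (rho t * b)); [ring|].
        rewrite Ea, Eb.
        replace (mu t * (rho t * cos (psi t) * cos nu - rho t * sin (psi t) * sin nu))
          with (mu t * rho t * (cos (psi t) * cos nu - sin (psi t) * sin nu)) by ring.
        rewrite <- T2, <- SC. ring.
Qed.

(** * First and second differences of the field, and of solutions *)

Lemma Rabs_le_inv x B : Rabs x <= B -> - B <= x <= B.
Proof. unfold Rabs; destruct Rcase_abs; lra. Qed.

Lemma Rabs_le_sqr x B : Rabs x <= B -> x * x <= B * B.
Proof. intros H. apply Rabs_le_inv in H. nra. Qed.

Lemma Rabs_le_sum_sqr p q : Rabs (2 * (p * q)) <= p * p + q * q.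
Proof.
  apply Rabs_le. pose proof (Rle_0_sqr (p + q)). pose proof (Rle_0_sqr (p - q)).
  unfold Rsqr in *. lra.
Qed.

Lemma Rabs_mult_le a b A B : Rabs a <= A -> Rabs b <= B -> Rabs (a * b) <= A * B.
Proof.
  intros Ha Hb. rewrite Rabs_mult.
  apply Rmult_le_compat; try apply Rabs_pos; assumption.
Qed.

(** The form is the imaginary part of [exp(i nu) (p + i q)^2], so it is controlled by [p^2 + q^2];
    the factor 2 comes from estimating its two terms separately. It is the contribution of the
    conjugate-linear term to the derivative of a squared distance. *)
Lemma reflection_form_bound p q nu :
  Rabs (2 * (p * q) * cos nu + (p * p - q * q) * sin nu) <= 2 * (p * p + q * q).
Proof.
  pose proof (COS_bound nu). pose proof (SIN_bound nu).
  pose proof (Rabs_le_sum_sqr p q) as H1.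
  assert (Rabs (2 * (p * q) * cos nu) <= (p * p + q * q) * 1)
    by (apply Rabs_mult_le; [exact H1|apply Rabs_le; lra]).
  assert (Rabs ((p * p - q * q) * sin nu) <= (p * p + q * q) * 1)
    by (apply Rabs_mult_le; apply Rabs_le; split; nra).
  eapply Rle_trans; [apply Rabs_triang|lra].
Qed.

Lemma two_linear_forms_bound a b c d p q A :
  a * a <= A -> b * b <= A -> c * c <= A -> d * d <= A ->
  Rabs ((a * p + b * q) * (c * p + d * q)) <= 2 * A * (p * p + q * q).
Proof.
  intros Ha Hb Hc Hd.
  assert (CS : forall u v, u * u <= A -> v * v <= A ->
            (u * p + v * q) * (u * p + v * q) <= 2 * A * (p * p + q * q)).
  { intros u v Hu Hv.
    assert ((u * p + v * q) * (u * p + v * q) <= (u * u + v * v) * (p * p + q * q)).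
    { pose proof (Rle_0_sqr (u * q - v * p)) as S. unfold Rsqr in S. lra. }
    assert ((u * u + v * v) * (p * p + q * q) <= (2 * A) * (p * p + q * q)).
    { apply Rmult_le_compat_r; [nra|lra]. }
    lra. }
  pose proof (CS a b Ha Hb). pose proof (CS c d Hc Hd).
  pose proof (Rabs_le_sum_sqr (a * p + b * q) (c * p + d * q)) as H1.
  rewrite Rabs_mult, (Rabs_pos_eq 2) in H1 by lra. lra.
Qed.

(* The radial part [i (|z|^2 - lam t) z] of the field is a rotation, hence the
   cancellation which leaves only the product of two linear forms. *)
Lemma field_diff_bound lam nu m t x1 y1 x2 y2 B Mm :
  Rabs x1 <= B -> Rabs y1 <= B -> Rabs x2 <= B -> Rabs y2 <= B -> Rabs m <= Mm ->
  Rabs (2 * ((x1 - x2) * (vx lam nu m t x1 y1 - vx lam nu m t x2 y2) +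
             (y1 - y2) * (vy lam nu m t x1 y1 - vy lam nu m t x2 y2)))
  <= (16 * (B * B) + 4 * Mm) * ((x1 - x2) * (x1 - x2) + (y1 - y2) * (y1 - y2)).
Proof.
  intros Hx1 Hy1 Hx2 Hy2 Hm.
  set (p := x1 - x2). set (q := y1 - y2).
  replace (2 * (p * (vx lam nu m t x1 y1 - vx lam nu m t x2 y2) +
                q * (vy lam nu m t x1 y1 - vy lam nu m t x2 y2)))
    with (2 * (((x1 + x2) * p + (y1 + y2) * q) * (- y2 * p + x2 * q)) +
          - 2 * (m * (2 * (p * q) * cos nu + (p * p - q * q) * sin nu)))
    by (unfold p, q, vx, vy; ring).
  assert (F : Rabs (((x1 + x2) * p + (y1 + y2) * q) * (- y2 * p + x2 * q))
              <= 2 * (4 * (B * B)) * (p * p + q * q)).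
  { assert (S : forall a b, Rabs a <= B -> Rabs b <= B -> (a + b) * (a + b) <= 4 * (B * B)).
    { intros a b Ha Hb. replace (4 * (B * B)) with (2 * B * (2 * B)) by ring.
      apply Rabs_le_sqr. eapply Rle_trans; [apply Rabs_triang|lra]. }
    pose proof (Rabs_le_sqr _ _ Hx2). pose proof (Rabs_le_sqr _ _ Hy2).
    pose proof (Rle_0_sqr B) as HB. unfold Rsqr in HB.
    apply two_linear_forms_bound; [apply S|apply S| |]; auto; lra. }
  pose proof (Rabs_mult_le _ _ _ _ Hm (reflection_form_bound p q nu)) as G.
  eapply Rle_trans; [apply Rabs_triang|].
  rewrite (Rabs_mult 2), (Rabs_mult (-2)), (Rabs_pos_eq 2), (Rabs_left (-2)) by lra.
  lra.
Qed.

Definition bounded_on (T B : R) (f : R -> R) : Prop :=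
  forall t, 0 <= t <= T -> Rabs (f t) <= B.

Definition sqdist (x1 y1 x2 y2 : R -> R) (t : R) : R :=
  (x1 t - x2 t) * (x1 t - x2 t) + (y1 t - y2 t) * (y1 t - y2 t).

Lemma sqdist_nonneg x1 y1 x2 y2 t : 0 <= sqdist x1 y1 x2 y2 t.
Proof. apply Rplus_le_le_0_compat; apply Rle_0_sqr. Qed.

(** The derivative of the squared distance is bounded in modulus by a multiple of that distance, so
    Gronwall works in both directions. The first bound gives uniqueness and continuity in the data,
    the second keeps distinct data apart at time [T]. *)
Lemma cart_dist_bounds lam nu mu B Mm T x1 y1 x2 y2 :
  0 <= T -> bounded_on T Mm mu ->
  cart_sol lam nu mu x1 y1 -> cart_sol lam nu mu x2 y2 ->
  bounded_on T B x1 -> bounded_on T B y1 -> bounded_on T B x2 -> bounded_on T B y2 ->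
  forall t, 0 <= t <= T ->
  sqdist x1 y1 x2 y2 t <= sqdist x1 y1 x2 y2 0 * exp ((16 * (B * B) + 4 * Mm) * T) /\
  sqdist x1 y1 x2 y2 0 <= sqdist x1 y1 x2 y2 t * exp ((16 * (B * B) + 4 * Mm) * T).
Proof.
  intros HT Hmu [Cx1 [Cy1 D1]] [Cx2 [Cy2 D2]] Bx1 By1 Bx2 By2 t Ht.
  set (K := 16 * (B * B) + 4 * Mm).
  assert (HK : 0 <= K).
  { assert (0 <= Mm) by (apply Rle_trans with (2 := Hmu 0 ltac:(lra)); apply Rabs_pos).
    unfold K. nra. }
  set (E' := fun s => 2 *
    ((x1 s - x2 s) * (vx lam nu (mu s) s (x1 s) (y1 s) - vx lam nu (mu s) s (x2 s) (y2 s)) +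
     (y1 s - y2 s) * (vy lam nu (mu s) s (x1 s) (y1 s) - vy lam nu (mu s) s (x2 s) (y2 s)))).
  assert (CE : cont_halfline (sqdist x1 y1 x2 y2)).
  { apply cont_halfline_plus; apply cont_halfline_mult;
      apply cont_halfline_minus; assumption. }
  assert (DE : forall s, 0 < s -> derivable_pt_lim (sqdist x1 y1 x2 y2) s (E' s)).
  { intros s Hs. destruct (D1 s Hs) as [dx1 dy1]. destruct (D2 s Hs) as [dx2 dy2].
    pose proof (derivable_pt_lim_minus _ _ _ _ _ dx1 dx2) as dx.
    pose proof (derivable_pt_lim_minus _ _ _ _ _ dy1 dy2) as dy.
    pose proof (derivable_pt_lim_plus _ _ _ _ _
      (derivable_pt_lim_mult _ _ _ _ _ dx dx) (derivable_pt_lim_mult _ _ _ _ _ dy dy)) as H.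
    unfold plus_fct, minus_fct, mult_fct in H.
    match type of H with derivable_pt_lim _ _ ?l => replace (E' s) with l; [exact H|] end.
    unfold E'. ring. }
  assert (BE : forall s, 0 < s -> s <= T -> Rabs (E' s) <= K * sqdist x1 y1 x2 y2 s).
  { intros s Hs HsT. apply field_diff_bound; [apply Bx1|apply By1|apply Bx2|apply By2|apply Hmu]; lra. }
  assert (P := sqdist_nonneg x1 y1 x2 y2).
  assert (X : exp (K * t) <= exp (K * T)).
  { destruct (Rle_lt_or_eq_dec _ _ (Rmult_le_compat_l K t T HK (proj2 Ht))) as [L| ->];
      [left; apply exp_increasing, L|right; reflexivity]. }
  split.
  - assert (G : sqdist x1 y1 x2 y2 t <= (sqdist x1 y1 x2 y2 0 + 0 * t) * exp (K * t)).
    { apply (gronwall_upper _ E'); auto; try lra.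
      intros s H1 H2. specialize (BE s H1 ltac:(lra)). apply Rabs_le_inv in BE. lra. }
    pose proof (P 0). nra.
  - assert (G : sqdist x1 y1 x2 y2 0 <= sqdist x1 y1 x2 y2 t * exp (K * t)).
    { apply (gronwall_lower _ E'); auto; try lra.
      intros s H1 H2. specialize (BE s H1 ltac:(lra)). apply Rabs_le_inv in BE. lra. }
    pose proof (P t). nra.
Qed.

(** Quadratic and cubic part of the Taylor expansion of [vx] at [(x, y)] in the displacement
    [(u, v)]. The terms with [lam * t] and [m] are linear and leave no trace. *)
Definition field_rem_x (x y u v : R) : R :=
  - (2 * (u * v) * x + 2 * (v * v) * y + (u * u + v * v) * y + (u * u + v * v) * v).
Definition field_rem_y (x y u v : R) : R :=
  2 * (u * u) * x + 2 * (u * v) * y + (u * u + v * v) * x + (u * u + v * v) * u.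

(** The four terms contribute 1, 2, 1 and 2 (in some order) times [B * (u * u + v * v)]. The bound
    [2 * B] on the displacement is that of a difference of two points of the box. *)
Lemma field_rem_bound x y u v B :
  Rabs x <= B -> Rabs y <= B -> Rabs u <= 2 * B -> Rabs v <= 2 * B ->
  Rabs (field_rem_x x y u v) <= 6 * B * (u * u + v * v) /\
  Rabs (field_rem_y x y u v) <= 6 * B * (u * u + v * v).
Proof.
  intros Hx Hy Hu Hv.
  assert (E0 : Rabs (u * u + v * v) <= u * u + v * v) by (rewrite Rabs_pos_eq; nra).
  assert (E1 : Rabs (2 * (u * v)) <= u * u + v * v) by apply Rabs_le_sum_sqr.
  assert (E2 : Rabs (2 * (u * u)) <= 2 * (u * u + v * v)) by (apply Rabs_le; split; nra).
  assert (E3 : Rabs (2 * (v * v)) <= 2 * (u * u + v * v)) by (apply Rabs_le; split; nra).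
  pose proof (Rabs_mult_le _ _ _ _ E0 Hx). pose proof (Rabs_mult_le _ _ _ _ E0 Hy).
  pose proof (Rabs_mult_le _ _ _ _ E0 Hu). pose proof (Rabs_mult_le _ _ _ _ E0 Hv).
  pose proof (Rabs_mult_le _ _ _ _ E1 Hx). pose proof (Rabs_mult_le _ _ _ _ E1 Hy).
  pose proof (Rabs_mult_le _ _ _ _ E2 Hx). pose proof (Rabs_mult_le _ _ _ _ E3 Hy).
  unfold field_rem_x, field_rem_y. rewrite Rabs_Ropp.
  split; (eapply Rle_trans; [apply Rabs_triang|]);
    (eapply Rle_trans; [apply Rplus_le_compat_r, Rabs_triang|]);
    (eapply Rle_trans; [apply Rplus_le_compat_r, Rplus_le_compat_r, Rabs_triang|]); lra.
Qed.

(** In the second difference the linearization at [(x0, y0)] acts on [(p, q)] and only the Taylor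
    remainders are left over. The linear part gives [8 * (B * B) + 4 * Mm]. Each remainder sum is at
    most [12 * B * e]; splitting [2 * p * Rx <= p^2 + Rx^2], and likewise for [q], adds the 1 and
    twice [144 * (B * B) * (e * e)]. *)
Lemma field_second_diff_bound lam nu m t x0 y0 x1 y1 x2 y2 B Mm e :
  Rabs x0 <= B -> Rabs y0 <= B -> Rabs x1 <= B -> Rabs y1 <= B ->
  Rabs x2 <= B -> Rabs y2 <= B -> Rabs m <= Mm ->
  (x1 - x0) * (x1 - x0) + (y1 - y0) * (y1 - y0) <= e ->
  (x2 - x0) * (x2 - x0) + (y2 - y0) * (y2 - y0) <= e ->
  2 * ((x1 + x2 - 2 * x0) *
         (vx lam nu m t x1 y1 + vx lam nu m t x2 y2 - 2 * vx lam nu m t x0 y0) +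
       (y1 + y2 - 2 * y0) *
         (vy lam nu m t x1 y1 + vy lam nu m t x2 y2 - 2 * vy lam nu m t x0 y0))
  <= (8 * (B * B) + 4 * Mm + 1) *
       ((x1 + x2 - 2 * x0) * (x1 + x2 - 2 * x0) + (y1 + y2 - 2 * y0) * (y1 + y2 - 2 * y0))
     + 288 * (B * B) * (e * e).
Proof.
  intros Hx0 Hy0 Hx1 Hy1 Hx2 Hy2 Hm He1 He2.
  set (p := x1 + x2 - 2 * x0). set (q := y1 + y2 - 2 * y0).
  set (Rx := field_rem_x x0 y0 (x1 - x0) (y1 - y0) + field_rem_x x0 y0 (x2 - x0) (y2 - y0)).
  set (Ry := field_rem_y x0 y0 (x1 - x0) (y1 - y0) + field_rem_y x0 y0 (x2 - x0) (y2 - y0)).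
  match goal with |- ?L <= _ =>
    replace L with (2 * (2 * ((x0 * p + y0 * q) * (- y0 * p + x0 * q)) -
       m * (2 * (p * q) * cos nu + (p * p - q * q) * sin nu)) + 2 * (p * Rx) + 2 * (q * Ry))
      by (unfold p, q, Rx, Ry, field_rem_x, field_rem_y, vx, vy; ring) end.
  assert (F : Rabs ((x0 * p + y0 * q) * (- y0 * p + x0 * q)) <= 2 * (B * B) * (p * p + q * q)).
  { pose proof (Rabs_le_sqr _ _ Hx0). pose proof (Rabs_le_sqr _ _ Hy0).
    apply two_linear_forms_bound; nra. }
  pose proof (Rabs_mult_le _ _ _ _ Hm (reflection_form_bound p q nu)) as G.
  assert (B0 : 0 <= B) by (apply Rle_trans with (2 := Hx0); apply Rabs_pos).
  assert (R1 := field_rem_bound x0 y0 (x1 - x0) (y1 - y0) B Hx0 Hy0).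
  assert (R2 := field_rem_bound x0 y0 (x2 - x0) (y2 - y0) B Hx0 Hy0).
  assert (D : forall a b, Rabs a <= B -> Rabs b <= B -> Rabs (a - b) <= 2 * B).
  { intros a b Ha Hb. apply Rabs_le_inv in Ha, Hb. apply Rabs_le. lra. }
  destruct R1 as [R1x R1y]; [apply D; assumption..|].
  destruct R2 as [R2x R2y]; [apply D; assumption..|].
  assert (C : forall a b, Rabs a <= 6 * B * ((x1 - x0) * (x1 - x0) + (y1 - y0) * (y1 - y0)) ->
             Rabs b <= 6 * B * ((x2 - x0) * (x2 - x0) + (y2 - y0) * (y2 - y0)) ->
             (a + b) * (a + b) <= 144 * (B * B) * (e * e)).
  { intros a b Ha Hb.
    replace (144 * (B * B) * (e * e)) with ((12 * B * e) * (12 * B * e)) by ring.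
    apply Rabs_le_sqr. eapply Rle_trans; [apply Rabs_triang|].
    pose proof (Rmult_le_compat_l B _ _ B0 He1). pose proof (Rmult_le_compat_l B _ _ B0 He2). lra. }
  assert (Sx : Rx * Rx <= 144 * (B * B) * (e * e)) by (apply C; assumption).
  assert (Sy : Ry * Ry <= 144 * (B * B) * (e * e)) by (apply C; assumption).
  apply Rabs_le_inv in F, G.
  pose proof (Rle_0_sqr (p - Rx)) as Zx. pose proof (Rle_0_sqr (q - Ry)) as Zy.
  unfold Rsqr in Zx, Zy.
  lra.
Qed.

(** Quantitative oddness of the flow: [e] bounds squared distances, so the squared second difference
    at time [T] is of fourth order in the displacement when it is so at time 0. [Q] is chosen before
    the solutions because the radius of the circle of data is fixed only after it. *)
Lemma cart_second_diff_bound lam nu mu B Mm T :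
  0 <= T -> bounded_on T Mm mu ->
  exists Q, 0 < Q /\ forall x0 y0 x1 y1 x2 y2 e,
    cart_sol lam nu mu x0 y0 -> cart_sol lam nu mu x1 y1 -> cart_sol lam nu mu x2 y2 ->
    bounded_on T B x0 -> bounded_on T B y0 -> bounded_on T B x1 -> bounded_on T B y1 ->
    bounded_on T B x2 -> bounded_on T B y2 ->
    sqdist x1 y1 x0 y0 0 <= e -> sqdist x2 y2 x0 y0 0 <= e ->
    sqdist (fun t => x1 t + x2 t) (fun t => y1 t + y2 t)
           (fun t => 2 * x0 t) (fun t => 2 * y0 t) T
    <= Q * (sqdist (fun t => x1 t + x2 t) (fun t => y1 t + y2 t)
           (fun t => 2 * x0 t) (fun t => 2 * y0 t) 0 + e * e).
Proof.
  intros HT Hmu.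
  assert (HMm : 0 <= Mm) by (apply Rle_trans with (2 := Hmu 0 ltac:(lra)); apply Rabs_pos).
  set (G := exp ((16 * (B * B) + 4 * Mm) * T)).
  set (K := 8 * (B * B) + 4 * Mm + 1).
  set (L := 288 * (B * B) * (G * G) * T).
  assert (HG : 0 < G) by apply exp_pos.
  assert (HB : 0 <= B * B) by nra.
  assert (HL : 0 <= L) by (unfold L; repeat (lra || apply Rmult_le_pos)).
  assert (HX : 0 < exp (K * T)) by apply exp_pos.
  exists ((1 + L) * exp (K * T)). split; [apply Rmult_lt_0_compat; lra|].
  intros x0 y0 x1 y1 x2 y2 e S0 S1 S2 Bx0 By0 Bx1 By1 Bx2 By2 E1 E2.
  set (N := sqdist (fun t => x1 t + x2 t) (fun t => y1 t + y2 t)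
           (fun t => 2 * x0 t) (fun t => 2 * y0 t)).
  assert (HN : 0 <= N 0) by apply sqdist_nonneg.
  assert (He : 0 <= e) by (apply Rle_trans with (2 := E1), sqdist_nonneg).
  assert (C1 := fun t Ht => proj1 (cart_dist_bounds lam nu mu B Mm T x1 y1 x0 y0
                 HT Hmu S1 S0 Bx1 By1 Bx0 By0 t Ht)).
  assert (C2 := fun t Ht => proj1 (cart_dist_bounds lam nu mu B Mm T x2 y2 x0 y0
                 HT Hmu S2 S0 Bx2 By2 Bx0 By0 t Ht)).
  destruct S0 as [Cx0 [Cy0 D0]], S1 as [Cx1 [Cy1 D1]], S2 as [Cx2 [Cy2 D2]].
  set (N' := fun s => 2 * ((x1 s + x2 s - 2 * x0 s) *
         (vx lam nu (mu s) s (x1 s) (y1 s) + vx lam nu (mu s) s (x2 s) (y2 s)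
          - 2 * vx lam nu (mu s) s (x0 s) (y0 s)) +
       (y1 s + y2 s - 2 * y0 s) *
         (vy lam nu (mu s) s (x1 s) (y1 s) + vy lam nu (mu s) s (x2 s) (y2 s)
          - 2 * vy lam nu (mu s) s (x0 s) (y0 s)))).
  assert (R : N T <= (N 0 + 288 * (B * B) * ((e * G) * (e * G)) * T) * exp (K * T)).
  { apply (gronwall_upper _ N').
    - assert (C2' : cont_halfline (fun _ => 2)) by (apply continuous_cont_halfline; reg).
      apply cont_halfline_plus; apply cont_halfline_mult; apply cont_halfline_minus;
        try (apply cont_halfline_plus; assumption); apply cont_halfline_mult; assumption.
    - exact HT.
    - unfold K; lra.
    - repeat (lra || apply Rmult_le_pos).
    - intros s Hs _. destruct (D0 s Hs) as [dx0 dy0].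
      destruct (D1 s Hs) as [dx1 dy1]. destruct (D2 s Hs) as [dx2 dy2].
      pose proof (derivable_pt_lim_minus _ _ _ _ _ (derivable_pt_lim_plus _ _ _ _ _ dx1 dx2)
                    (derivable_pt_lim_scal _ 2 _ _ dx0)) as dx.
      pose proof (derivable_pt_lim_minus _ _ _ _ _ (derivable_pt_lim_plus _ _ _ _ _ dy1 dy2)
                    (derivable_pt_lim_scal _ 2 _ _ dy0)) as dy.
      pose proof (derivable_pt_lim_plus _ _ _ _ _
        (derivable_pt_lim_mult _ _ _ _ _ dx dx) (derivable_pt_lim_mult _ _ _ _ _ dy dy)) as H.
      unfold plus_fct, minus_fct, mult_fct, mult_real_fct in H.
      match type of H with derivable_pt_lim _ _ ?l => replace (N' s) with l; [exact H|] end.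
      unfold N'. ring.
    - intros s Hs HsT.
      apply field_second_diff_bound;
        [apply Bx0|apply By0|apply Bx1|apply By1|apply Bx2|apply By2|apply Hmu| |]; try lra.
      + eapply Rle_trans; [apply (C1 s); lra|]. apply Rmult_le_compat_r; [left; exact HG|exact E1].
      + eapply Rle_trans; [apply (C2 s); lra|]. apply Rmult_le_compat_r; [left; exact HG|exact E2]. }
  eapply Rle_trans; [exact R|].
  replace (288 * (B * B) * (e * G * (e * G)) * T) with (L * (e * e)) by (unfold L; ring).
  replace ((1 + L) * exp (K * T) * (N 0 + e * e))
    with ((1 + L) * (N 0 + e * e) * exp (K * T)) by ring.
  apply Rmult_le_compat_r; [left; exact HX|]. nra.
Qed.

(** * Escape from the expanding quadrant *)

(** The supremum of the initial segments on which [P] holds belongs to [P] by the closing condition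
    and would be exceeded by the opening one. This serves to keep a trajectory inside an open
    quadrant. *)
Lemma real_induction (P : R -> Prop) a :
  P a ->
  (forall t, a <= t -> P t -> exists d, 0 < d /\ forall s, t <= s < t + d -> P s) ->
  (forall t, a < t -> (forall s, a <= s < t -> P s) -> P t) ->
  forall t, a <= t -> P t.
Proof.
  intros Pa Hopen Hclosed t Ht. apply NNPP. intros NP.
  set (S := fun s => a <= s /\ forall u, a <= u <= s -> P u).
  assert (Sa : S a).
  { split; [lra|]. intros u Hu. replace u with a by lra. exact Pa. }
  assert (Sb : is_upper_bound S t).
  { intros s [Hs Hu]. destruct (Rle_dec s t) as [H|H]; [exact H|].
    exfalso. apply NP, Hu. lra. }
  destruct (completeness S) as [m [Um Lm]]; [exists t; exact Sb|exists a; exact Sa|].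
  assert (Ham : a <= m) by exact (Um a Sa).
  assert (Below : forall u, a <= u < m -> P u).
  { intros u Hu. apply NNPP. intros Nu.
    enough (m <= u) by lra. apply Lm. intros s [Hs HS].
    destruct (Rle_dec s u) as [H|H]; [exact H|]. exfalso. apply Nu, HS. lra. }
  assert (Pm : P m).
  { destruct (Req_dec a m) as [<-|N]; [exact Pa|]. apply Hclosed; [lra|exact Below]. }
  destruct (Hopen m Ham Pm) as [d [Hd H]].
  assert (m + d / 2 <= m); [|lra].
  apply Um. split; [lra|]. intros u Hu.
  destruct (Rlt_le_dec u m); [apply Below|apply H]; lra.
Qed.

Lemma sin_lipschitz u v : Rabs (sin u - sin v) <= Rabs (u - v).
Proof.
  destruct (MVT_abs sin cos v u) as [c [E _]]; [intros; apply derivable_pt_lim_sin|].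
  rewrite E. pose proof (COS_bound c). pose proof (Rabs_pos (u - v)).
  assert (Rabs (cos c) <= 1) by (apply Rabs_le; lra). nra.
Qed.

Lemma cos_lipschitz u v : Rabs (cos u - cos v) <= Rabs (u - v).
Proof.
  destruct (MVT_abs cos (fun x => - sin x) v u) as [c [E _]];
    [intros; apply derivable_pt_lim_cos|].
  rewrite E. pose proof (SIN_bound c). pose proof (Rabs_pos (u - v)).
  assert (Rabs (- sin c) <= 1) by (apply Rabs_le; lra). nra.
Qed.

Definition frho (nu m rho psi : R) : R := sin psi - m * rho * sin (2 * psi + nu).
Definition fpsi (lam nu m t rho psi : R) : R :=
  rho ^ 2 - lam * t + cos psi / rho - m * cos (2 * psi + nu).

Lemma MS_polar lam nu mu rho psi t :
  MS_sol lam nu mu None rho psi -> 0 < t -> rho t <> 0 ->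
  derivable_pt_lim rho t (frho nu (mu t) (rho t) (psi t)) /\
  derivable_pt_lim psi t (fpsi lam nu (mu t) t (rho t) (psi t)).
Proof.
  intros [_ [HD _]] Ht Hr.
  destruct (HD t) as [a [b [Ha [Hb [E1 E2]]]]]; [split; [lra|exact I]|exact Ht|].
  replace (frho nu (mu t) (rho t) (psi t)) with a by (unfold frho; lra).
  replace (fpsi lam nu (mu t) t (rho t) (psi t)) with b; [split; assumption|].
  apply (Rmult_eq_reg_l (rho t)); [|exact Hr]. unfold fpsi.
  transitivity (cos (psi t) - mu t * rho t * cos (2 * psi t + nu)
                + rho t * (rho t ^ 2 - lam * t)); [lra|field; exact Hr].
Qed.

(** [q] stands for [sqrt t] and [(r, p)] for the displacement from [(r0, p0)]. Multiplied by [q],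
    the right-hand side is at least [c p^2 + a (q r)^2 - (3 C + 1/a) r p]. The squares dominate
    [2 k q r p], and the threshold on [q] lets half of this absorb the cross term. *)
Lemma hyperbolic_growth lam nu m t q r0 p0 r p a C c k :
  0 < a -> 0 < q -> 1 <= a * q -> a * q <= r0 -> 0 < r -> 0 < p -> 0 < C ->
  Rabs m * q <= C -> 0 < k -> k <= a -> k <= c -> 3 * C + / a <= k * q ->
  c * p <= q * (sin (p0 + p) - sin p0
                - m * r0 * (sin (2 * (p0 + p) + nu) - sin (2 * p0 + nu))) ->
  k * (r * p) <= (frho nu m (r0 + r) (p0 + p) - frho nu m r0 p0) * p
               + r * (fpsi lam nu m t (r0 + r) (p0 + p) - fpsi lam nu m t r0 p0).
Proof.
  intros Ha Hq Haq Hr0 Hr Hp HC Hm Hk Hka Hkc HD HG.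
  assert (Hm' : forall u, Rabs u <= 1 -> Rabs (q * (m * u)) <= C).
  { intros u Hu. replace (q * (m * u)) with ((q * m) * u) by ring.
    rewrite <- (Rmult_1_r C). apply Rabs_mult_le; [|exact Hu].
    rewrite Rabs_mult, (Rabs_pos_eq q) by lra. lra. }
  assert (A1 : c * p - C * r <= q * (frho nu m (r0 + r) (p0 + p) - frho nu m r0 p0)).
  { unfold frho.
    assert (H := Hm' (sin (2 * (p0 + p) + nu)) ltac:(apply Rabs_le, SIN_bound)).
    apply Rabs_le_inv in H.
    assert (q * (m * sin (2 * (p0 + p) + nu)) * r <= C * r) by (apply Rmult_le_compat_r; lra).
    lra. }
  (* Of the main term [2 * r0 * r >= 2 * a * q * r], half is spent on the change of [cos p0 / rho]
     with [rho], which costs at most [r <= a * q * r] since both radii are at least 1. *)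
  assert (A2 : a * (q * q) * r - (/ a + 2 * C) * p <=
     q * (fpsi lam nu m t (r0 + r) (p0 + p) - fpsi lam nu m t r0 p0)).
  { set (rr := r0 + r).
    assert (Hrr : a * q <= rr) by (unfold rr; lra).
    assert (I0 : 0 < / rr) by (apply Rinv_0_lt_compat; lra).
    assert (I1 : q * / rr <= / a).
    { apply (Rmult_le_reg_r (a * rr)); [nra|]. field_simplify; lra. }
    assert (I2 : / rr * / r0 <= 1).
    { rewrite <- Rinv_mult, <- Rinv_1. apply Rinv_le_contravar; nra. }
    assert (I3 : 0 < / rr * / r0).
    { apply Rmult_lt_0_compat; [exact I0|apply Rinv_0_lt_compat; lra]. }
    assert (L : Rabs (cos (p0 + p) - cos p0) <= p).
    { eapply Rle_trans; [apply cos_lipschitz|]. rewrite Rabs_pos_eq; lra. }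
    apply Rabs_le_inv in L.
    assert (L2 := cos_lipschitz (2 * (p0 + p) + nu) (2 * p0 + nu)).
    replace (2 * (p0 + p) + nu - (2 * p0 + nu)) with (2 * p) in L2 by ring.
    rewrite (Rabs_pos_eq (2 * p)) in L2 by lra.
    assert (L3 : q * m * (cos (2 * (p0 + p) + nu) - cos (2 * p0 + nu)) <= C * (2 * p)).
    { eapply Rle_trans; [apply Rle_abs|]. apply Rabs_mult_le; [|exact L2].
      rewrite Rabs_mult, (Rabs_pos_eq q) by lra. lra. }
    replace (fpsi lam nu m t rr (p0 + p) - fpsi lam nu m t r0 p0)
      with (2 * r0 * r + r * r + (cos (p0 + p) - cos p0) * / rr
            - cos p0 * (r * (/ rr * / r0)) - m * (cos (2 * (p0 + p) + nu) - cos (2 * p0 + nu)))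
      by (unfold fpsi, rr; field; lra).
    pose proof (COS_bound p0).
    assert (q * ((cos (p0 + p) - cos p0) * / rr) >= - (p * / a)).
    { replace (q * ((cos (p0 + p) - cos p0) * / rr))
        with ((cos (p0 + p) - cos p0) * (q * / rr)) by ring.
      assert (0 < q * / rr) by (apply Rmult_lt_0_compat; lra). nra. }
    assert (cos p0 * (r * (/ rr * / r0)) <= r).
    { assert (0 < r * (/ rr * / r0)) by (apply Rmult_lt_0_compat; lra).
      assert (r * (/ rr * / r0) <= r * 1) by (apply Rmult_le_compat_l; lra). nra. }
    assert (q * (cos p0 * (r * (/ rr * / r0))) <= q * r) by (apply Rmult_le_compat_l; lra).
    assert (q * (2 * r0 * r) >= 2 * (a * q) * (q * r)).
    { assert (0 < q * r) by (apply Rmult_lt_0_compat; lra). nra. }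
    assert (q * r <= a * q * (q * r)).
    { assert (0 < q * r) by (apply Rmult_lt_0_compat; lra). nra. }
    assert (0 < q * (r * r)) by (repeat apply Rmult_lt_0_compat; lra).
    lra. }
  apply (Rmult_le_reg_l q); [exact Hq|].
  assert (0 < r * p) by (apply Rmult_lt_0_compat; lra).
  assert (B1 := Rmult_le_compat_r p _ _ ltac:(lra) A1).
  assert (B2 := Rmult_le_compat_l r _ _ ltac:(lra) A2).
  assert (B3 : k * (p * p) <= c * (p * p)) by (apply Rmult_le_compat_r; nra).
  assert (B4 : k * ((q * r) * (q * r)) <= a * ((q * r) * (q * r))) by (apply Rmult_le_compat_r; nra).
  assert (B5 : (3 * C + / a) * (r * p) <= k * q * (r * p)) by (apply Rmult_le_compat_r; lra).
  (* The square [k * (p - q * r)^2 >= 0] supplies [2 * k * q * r * p]; [B5] consumes half of it. *)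
  assert (B6 := Rmult_le_compat_l k _ _ ltac:(lra) (Rle_0_sqr (p - q * r))).
  unfold Rsqr in B6. lra.
Qed.

Lemma continuity_pt_pos_near f t :
  continuity_pt f t -> 0 < f t -> exists d, 0 < d /\ forall s, t <= s < t + d -> 0 < f s.
Proof.
  intros Hf Hp. destruct (Hf (f t) Hp) as [d [Hd H]].
  exists d; split; [exact Hd|]. intros s Hs.
  destruct (Req_dec s t) as [->|N]; [exact Hp|].
  specialize (H s). simpl in H. unfold Rdist in H.
  assert (Rabs (f s - f t) < f t).
  { apply H. split; [split; [exact I|lra]|]. rewrite Rabs_pos_eq; lra. }
  apply Rabs_def2 in H0. lra.
Qed.

Lemma continuity_pt_nonneg_limit f a t :
  continuity_pt f t -> a < t -> (forall s, a <= s < t -> 0 < f s) -> 0 <= f t.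
Proof.
  intros Hf Hat Hp. destruct (Rle_lt_dec 0 (f t)) as [H|H]; [exact H|].
  destruct (Hf (- f t) ltac:(lra)) as [d [Hd Hc]].
  set (s := Rmax a (t - d / 2)).
  assert (a <= s /\ t - d / 2 <= s /\ s < t).
  { unfold s. repeat split; [apply Rmax_l|apply Rmax_r|apply Rmax_lub_lt; lra]. }
  specialize (Hc s). simpl in Hc. unfold Rdist in Hc.
  assert (Rabs (f s - f t) < - f t).
  { apply Hc. split; [split; [exact I|lra]|]. apply Rabs_def1; lra. }
  specialize (Hp s ltac:(lra)). apply Rabs_def2 in H1. lra.
Qed.

(** As long as both [r] and [p] are positive, [r * p] increases. On the boundary of the quadrant
    this product vanishes, so the boundary is never reached. Linear growth of [r * p] already
    contradicts [r + p < eps]. *)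
Lemma quadrant_escape lam nu mu rs ps rho psi a C c k eps T :
  MS_sol lam nu mu None rs ps -> MS_sol lam nu mu None rho psi ->
  0 < T -> 0 < a -> 0 < C -> 0 < k -> k <= a -> k <= c ->
  1 <= a * sqrt T -> 3 * C + / a <= k * sqrt T ->
  (forall t, T <= t -> a * sqrt t <= rs t) ->
  (forall t, T <= t -> Rabs (mu t) * sqrt t <= C) ->
  (forall t p, T <= t -> 0 <= p <= eps ->
     c * p <= sqrt t * (sin (ps t + p) - sin (ps t)
        - mu t * rs t * (sin (2 * (ps t + p) + nu) - sin (2 * ps t + nu)))) ->
  (forall t, T <= t -> Rabs (rho t - rs t) + Rabs (psi t - ps t) < eps) ->
  rs T < rho T -> ps T < psi T -> False.
Proof.
  intros Ss S HT Ha HC Hk Hka Hkc HaT HkT Hrs Hmu HG Hst Hr0 Hp0.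
  set (r := fun t => rho t - rs t). set (p := fun t => psi t - ps t).
  set (W' := fun t =>
    (frho nu (mu t) (rho t) (psi t) - frho nu (mu t) (rs t) (ps t)) * p t +
    r t * (fpsi lam nu (mu t) t (rho t) (psi t) - fpsi lam nu (mu t) t (rs t) (ps t))).
  destruct (MS_sol_cont _ _ _ _ _ Ss) as [Crs Cps].
  destruct (MS_sol_cont _ _ _ _ _ S) as [Crho Cpsi].
  assert (Cr : cont_halfline r) by (apply cont_halfline_minus; assumption).
  assert (Cp : cont_halfline p) by (apply cont_halfline_minus; assumption).
  assert (HqT : forall t, T <= t -> sqrt T <= sqrt t) by (intros; apply sqrt_le_1; lra).
  assert (HqT0 : 0 < sqrt T) by (apply sqrt_lt_R0; exact HT).
  assert (HW : forall t, T <= t -> 0 < r t -> 0 < p t ->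
            derivable_pt_lim (fun s => r s * p s) t (W' t) /\ k * (r t * p t) <= W' t).
  { intros t Ht Hr Hp. specialize (HqT t Ht).
    assert (1 <= a * sqrt t) by nra.
    specialize (Hrs t Ht).
    assert (rho t = rs t + r t) by (unfold r; ring).
    assert (psi t = ps t + p t) by (unfold p; ring).
    split.
    - destruct (MS_polar lam nu mu rs ps t Ss) as [d1 d2]; [lra|lra|].
      destruct (MS_polar lam nu mu rho psi t S) as [d3 d4]; [lra|lra|].
      exact (derivable_pt_lim_mult _ _ _ _ _ (derivable_pt_lim_minus _ _ _ _ _ d3 d1)
               (derivable_pt_lim_minus _ _ _ _ _ d4 d2)).
    - unfold W'. rewrite H0, H1.
      apply (hyperbolic_growth lam nu (mu t) t (sqrt t) (rs t) (ps t) (r t) (p t) a C c k);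
        auto; try lra; try nra.
      apply HG; [exact Ht|]. specialize (Hst t Ht). fold (r t) (p t) in Hst.
      pose proof (Rabs_pos (r t)). rewrite (Rabs_pos_eq (p t)) in Hst by lra. lra. }
  assert (Mono : forall t, T < t -> (forall s, T <= s < t -> 0 < r s /\ 0 < p s) ->
     exists b, T < b < t /\ r t * p t - r T * p T = W' b * (t - T)).
  { intros t Ht Hs. apply (mvt_halfline (fun s => r s * p s) W').
    - apply cont_halfline_mult; assumption.
    - lra.
    - intros s Hs'. apply HW; [lra|apply Hs; lra|apply Hs; lra]. }
  assert (Pos : forall t, T <= t -> 0 < r t /\ 0 < p t).
  { apply real_induction.
    - unfold r, p; lra.
    - intros t Ht [Hr Hp].
      destruct (continuity_pt_pos_near r t) as [d1 [Hd1 H1]];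
        [apply cont_halfline_pos_pt; [exact Cr|lra]|exact Hr|].
      destruct (continuity_pt_pos_near p t) as [d2 [Hd2 H2]];
        [apply cont_halfline_pos_pt; [exact Cp|lra]|exact Hp|].
      exists (Rmin d1 d2). split; [apply Rmin_glb_lt; assumption|].
      intros s Hs. pose proof (Rmin_l d1 d2). pose proof (Rmin_r d1 d2).
      split; [apply H1|apply H2]; lra.
    - intros t Ht Hs.
      assert (0 <= r t) by (apply (continuity_pt_nonneg_limit r T);
        [apply cont_halfline_pos_pt; [exact Cr|lra]|exact Ht|intros; apply Hs; lra]).
      assert (0 <= p t) by (apply (continuity_pt_nonneg_limit p T);
        [apply cont_halfline_pos_pt; [exact Cp|lra]|exact Ht|intros; apply Hs; lra]).
      destruct (Mono t Ht Hs) as [b [Hb E]].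
      destruct (Hs b ltac:(lra)) as [Rb Pb].
      destruct (HW b ltac:(lra) Rb Pb) as [_ Wb].
      assert (0 < r T * p T) by (apply Rmult_lt_0_compat; unfold r, p; lra).
      assert (0 < W' b) by (apply Rlt_le_trans with (2 := Wb);
        repeat apply Rmult_lt_0_compat; assumption).
      assert (0 < W' b * (t - T)) by (apply Rmult_lt_0_compat; lra).
      assert (0 < r t * p t) by lra.
      split; nra. }
  assert (HWT : 0 < r T * p T) by (apply Rmult_lt_0_compat; unfold r, p; lra).
  assert (Incr : forall t, T < t -> r T * p T <= r t * p t).
  { intros t Ht. destruct (Mono t Ht) as [b [Hb E]]; [intros; apply Pos; lra|].
    destruct (Pos b ltac:(lra)) as [Rb Pb].
    destruct (HW b ltac:(lra) Rb Pb) as [_ Wb].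
    assert (0 < W' b) by (apply Rlt_le_trans with (2 := Wb);
      repeat apply Rmult_lt_0_compat; assumption).
    assert (0 < W' b * (t - T)) by (apply Rmult_lt_0_compat; lra). lra. }
  set (w := k * (r T * p T)).
  assert (Hw : 0 < w) by (apply Rmult_lt_0_compat; assumption).
  assert (He : 0 < eps).
  { eapply Rle_lt_trans; [|apply (Hst T); lra].
    apply Rplus_le_le_0_compat; apply Rabs_pos. }
  (* [w] bounds the growth rate of [r * p] from below at all later times, so by this [t] the product
     has reached [eps * eps]. *)
  set (t := T + eps * eps / w).
  assert (Hx : 0 < eps * eps / w) by (apply Rdiv_lt_0_compat; [apply Rmult_lt_0_compat; exact He|exact Hw]).
  destruct (Mono t) as [b [Hb E]]; [unfold t; lra|intros; apply Pos; lra|].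
  destruct (Pos b ltac:(lra)) as [Rb Pb].
  destruct (HW b ltac:(lra) Rb Pb) as [_ Wb].
  assert (w <= W' b).
  { eapply Rle_trans; [|exact Wb]. apply Rmult_le_compat_l; [lra|]. apply Incr; lra. }
  assert (w * (t - T) = eps * eps) by (unfold t; field; lra).
  assert (eps * eps <= r t * p t) by (unfold t in *; nra).
  specialize (Hst t ltac:(unfold t; lra)). fold (r t) (p t) in Hst.
  destruct (Pos t ltac:(unfold t; lra)) as [Rt Pt].
  rewrite !Rabs_pos_eq in Hst by lra. nra.
Qed.

(** * Initial data on a small circle *)

(* Near [t = 0] the point [rho exp(i psi)] moves along [i t], so [psi] must start
   vertically. *)
Lemma start_at_zero_vertical lam nu mu rho psi :
  cont_halfline mu -> MS_sol lam nu mu None rho psi -> rho 0 = 0 -> cos (psi 0) = 0.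
Proof.
  intros Cmu S H0. destruct (MS_cart _ _ _ _ _ S) as [Cx [Cy D]].
  destruct (MS_sol_cont _ _ _ _ _ S) as [_ Cpsi].
  set (x := fun t => rho t * cos (psi t)) in *. set (y := fun t => rho t * sin (psi t)) in *.
  set (F1 := fun t => vx lam nu (mu t) t (x t) (y t)).
  set (F2 := fun t => vy lam nu (mu t) t (x t) (y t)).
  assert (x0 : x 0 = 0) by (unfold x; rewrite H0; ring).
  assert (y0 : y 0 = 0) by (unfold y; rewrite H0; ring).
  assert (Cc : forall k, cont_halfline (fun _ => k)) by (intros; apply continuous_cont_halfline; reg).
  assert (Ci : cont_halfline (fun t => t)) by (apply continuous_cont_halfline; reg).
  assert (Cn : cont_halfline (fun t => x t ^ 2 + y t ^ 2 - lam * t)).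
  { apply cont_halfline_minus; [apply cont_halfline_plus|apply cont_halfline_mult; auto];
      [apply (cont_halfline_comp x (fun u => u ^ 2))|apply (cont_halfline_comp y (fun u => u ^ 2))];
      try assumption; reg. }
  assert (C1 : cont_halfline F1).
  { apply cont_halfline_minus; apply cont_halfline_mult; auto.
    - apply (cont_halfline_comp (fun t => x t ^ 2 + y t ^ 2 - lam * t) Ropp); [exact Cn|].
      intros u. apply (continuity_pt_opp id), derivable_continuous, derivable_id.
    - apply cont_halfline_plus; apply cont_halfline_mult; auto. }
  assert (C2 : cont_halfline F2).
  { apply cont_halfline_minus; [apply cont_halfline_plus; [auto|]|];
      apply cont_halfline_mult; auto.
    apply cont_halfline_minus; apply cont_halfline_mult; auto. }
  assert (F10 : F1 0 = 0) by (unfold F1, vx; rewrite x0, y0; ring).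
  assert (F20 : F2 0 = 1) by (unfold F2, vy; rewrite x0, y0; ring).
  apply NNPP. intros Nc. set (k := Rabs (cos (psi 0))).
  assert (Hk : 0 < k) by (apply Rabs_pos_lt; exact Nc).
  destruct (cont_halfline_near0 F1 (k / 4) C1) as [d1 [Hd1 N1]]; [lra|].
  destruct (cont_halfline_near0 F2 (1 / 2) C2) as [d2 [Hd2 N2]]; [lra|].
  destruct (cont_halfline_near0 (fun t => cos (psi t)) (k / 4)) as [d3 [Hd3 N3]];
    [apply (cont_halfline_comp psi cos); [exact Cpsi|apply continuity_cos]|lra|].
  set (t := Rmin d1 (Rmin d2 d3) / 2).
  assert (Ht : 0 < t /\ t < d1 /\ t < d2 /\ t < d3).
  { assert (0 < Rmin d1 (Rmin d2 d3)) by (repeat apply Rmin_glb_lt; assumption).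
    pose proof (Rmin_l d1 (Rmin d2 d3)). pose proof (Rmin_r d1 (Rmin d2 d3)).
    pose proof (Rmin_l d2 d3). pose proof (Rmin_r d2 d3). unfold t. lra. }
  destruct (mvt_halfline x F1 0 t Cx) as [b1 [Hb1 E1]]; [lra|intros; apply D; lra|].
  destruct (mvt_halfline y F2 0 t Cy) as [b2 [Hb2 E2]]; [lra|intros; apply D; lra|].
  specialize (N1 b1 ltac:(lra)). specialize (N2 b2 ltac:(lra)). specialize (N3 t ltac:(lra)).
  rewrite F10, Rminus_0_r in N1. rewrite F20 in N2.
  rewrite x0, !Rminus_0_r in E1. rewrite y0, !Rminus_0_r in E2.
  (* This is [x sin psi = y cos psi] divided by [t]. The left side is at most [k / 4] in modulus;
     the right side is at least [1/2 * (3 k / 4)], a contradiction. *)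
  assert (E : F1 b1 * sin (psi t) = F2 b2 * cos (psi t)).
  { apply (Rmult_eq_reg_r t); [|lra].
    transitivity (x t * sin (psi t)); [rewrite E1; ring|].
    transitivity (y t * cos (psi t)); [unfold x, y; ring|rewrite E2; ring]. }
  assert (L : Rabs (F1 b1 * sin (psi t)) <= k / 4 * 1).
  { apply Rabs_mult_le; [lra|apply Rabs_le, SIN_bound]. }
  rewrite E, Rabs_mult in L. apply Rabs_def2 in N2.
  rewrite (Rabs_pos_eq (F2 b2)) in L by lra.
  assert (k <= Rabs (cos (psi t)) + k / 4).
  { unfold k at 1. replace (cos (psi 0)) with (cos (psi t) - (cos (psi t) - cos (psi 0))) by ring.
    eapply Rle_trans; [apply Rabs_triang|]. rewrite Rabs_Ropp. lra. }
  nra.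
Qed.

Lemma stable_rho0_neq0 lam nu mu rs ps :
  cont_halfline mu -> lyap_stable lam nu mu rs ps -> rs 0 <> 0.
Proof.
  intros Cmu Hst H0. destruct (Hst 1 ltac:(lra)) as [eta [He H]].
  assert (E : exists e, Rabs e < eta /\ cos (ps 0 + e) <> 0).
  { destruct (Req_dec (cos (ps 0)) 0) as [Hc|Hc].
    (* Here [cos (ps 0 + e) = - sin (ps 0) * sin e], and [0 < e <= 1] keeps [sin e] positive. *)
    - exists (Rmin (eta / 2) 1). pose proof (Rmin_l (eta / 2) 1). pose proof (Rmin_r (eta / 2) 1).
      assert (0 < Rmin (eta / 2) 1) by (apply Rmin_glb_lt; lra).
      split; [rewrite Rabs_pos_eq; lra|].
      rewrite cos_plus, Hc. pose proof (sin2_cos2 (ps 0)) as P. rewrite Hc in P. unfold Rsqr in P.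
      assert (0 < sin (Rmin (eta / 2) 1)) by (apply sin_gt_0; [lra|pose proof PI2_1; lra]).
      intros Z. assert (sin (ps 0) = 0) by nra. rewrite H5 in P. lra.
    - exists 0. rewrite Rabs_R0, Rplus_0_r. split; assumption. }
  destruct E as [e [He1 He2]].
  destruct (H 0 (ps 0 + e)) as [[rho [psi [S [R0 P0]]]] _].
  { rewrite H0, Rminus_0_r, Rabs_R0. replace (ps 0 + e - ps 0) with e by ring. lra. }
  apply He2. rewrite <- P0. exact (start_at_zero_vertical _ _ _ _ _ Cmu S R0).
Qed.

(** * Geometry of the circle of initial data *)

Lemma one_minus_cos_bound u : 0 <= 1 - cos u <= u ^ 2 / 2.
Proof.
  pose proof (COS_bound u). split; [lra|].
  replace u with (2 * (u / 2)) at 1 by field. rewrite cos_2a_sin.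
  pose proof (sin_lipschitz (u / 2) 0) as L. rewrite sin_0, !Rminus_0_r in L.
  apply Rsqr_le_abs_1 in L. unfold Rsqr in L. nra.
Qed.

Lemma sin_sqr_lower u : Rabs u <= 1 -> u ^ 2 / 4 <= sin u ^ 2.
Proof.
  intros Hu. destruct (MVT_abs sin cos 0 u) as [c [E Hc]]; [intros; apply derivable_pt_lim_sin|].
  rewrite sin_0, !Rminus_0_r in E. rewrite <- Rabs_mult in E.
  apply Rsqr_eq_asb_1 in E. unfold Rsqr in E.
  apply Rabs_le_inv in Hu.
  assert (-1 <= c <= 1) by (revert Hc; unfold Rmin, Rmax; destruct Rle_dec; lra).
  pose proof (one_minus_cos_bound c). assert (1 / 2 <= cos c) by nra.
  assert (1 / 4 <= cos c * cos c) by nra.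
  assert (u ^ 2 / 4 <= cos c * cos c * u ^ 2) by nra. nra.
Qed.

(** The circle is round in the [(rho, psi)] plane, where stability measures the data, and is read
    off in Cartesian coordinates. The radius [s] is signed: the antipode is obtained from [- s], so
    angles in [[0, PI]] suffice. *)
Definition circle_x (r0 P s th : R) : R := (r0 + s * cos th) * cos (P + s * sin th).
Definition circle_y (r0 P s th : R) : R := (r0 + s * cos th) * sin (P + s * sin th).

Lemma circle_dist r0 P s th :
  (circle_x r0 P s th - r0 * cos P) * (circle_x r0 P s th - r0 * cos P) +
  (circle_y r0 P s th - r0 * sin P) * (circle_y r0 P s th - r0 * sin P)
  <= 2 * (1 + Rabs r0) ^ 2 * s ^ 2.
Proof.
  pose proof (COS_bound th). pose proof (SIN_bound th).
  assert (Hc : Rabs (s * cos th) <= Rabs s * 1)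
    by (apply Rabs_mult_le; [lra|apply Rabs_le; lra]).
  assert (Hs : Rabs (s * sin th) <= Rabs s * 1)
    by (apply Rabs_mult_le; [lra|apply Rabs_le; lra]).
  assert (HH : forall f : R -> R, (forall u, Rabs (f u) <= 1) ->
    (forall u v, Rabs (f u - f v) <= Rabs (u - v)) ->
    ((r0 + s * cos th) * f (P + s * sin th) - r0 * f P) *
    ((r0 + s * cos th) * f (P + s * sin th) - r0 * f P) <= (1 + Rabs r0) ^ 2 * s ^ 2).
  { intros f B L.
    replace ((1 + Rabs r0) ^ 2 * s ^ 2) with (((1 + Rabs r0) * Rabs s) * ((1 + Rabs r0) * Rabs s)).
    2:{ rewrite <- (pow2_abs s). ring. }
    apply Rabs_le_sqr.
    replace ((r0 + s * cos th) * f (P + s * sin th) - r0 * f P)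
      with (s * cos th * f (P + s * sin th) + r0 * (f (P + s * sin th) - f P)) by ring.
    eapply Rle_trans; [apply Rabs_triang|].
    specialize (L (P + s * sin th) P).
    replace (P + s * sin th - P) with (s * sin th) in L by ring.
    pose proof (Rabs_mult_le _ _ _ _ Hc (B (P + s * sin th))).
    pose proof (Rabs_mult_le _ _ _ _ (Rle_refl (Rabs r0)) (Rle_trans _ _ _ L Hs)). lra. }
  pose proof (HH cos (fun u => Rabs_le _ _ (COS_bound u)) cos_lipschitz).
  pose proof (HH sin (fun u => Rabs_le _ _ (SIN_bound u)) sin_lipschitz).
  unfold circle_x, circle_y. lra.
Qed.

(** The terms linear in [s] cancel in the antipodal sum. Left are [r0 (cos al - 1)] and [c sin al],
    with [al = s sin th] and [c = s cos th], both [O(s^2)], whence the fourth power after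
    squaring. *)
Lemma circle_antipodal_mean r0 P s th :
  (circle_x r0 P s th + circle_x r0 P (- s) th - 2 * (r0 * cos P)) *
  (circle_x r0 P s th + circle_x r0 P (- s) th - 2 * (r0 * cos P)) +
  (circle_y r0 P s th + circle_y r0 P (- s) th - 2 * (r0 * sin P)) *
  (circle_y r0 P s th + circle_y r0 P (- s) th - 2 * (r0 * sin P))
  <= 2 * (2 + 2 * Rabs r0) ^ 2 * (s ^ 2 * s ^ 2).
Proof.
  unfold circle_x, circle_y.
  replace (- s * cos th) with (- (s * cos th)) by ring.
  replace (P + - s * sin th) with (P - s * sin th) by ring.
  set (al := s * sin th). set (c := s * cos th).
  rewrite cos_plus, cos_minus, sin_plus, sin_minus.
  pose proof (COS_bound th). pose proof (SIN_bound th).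
  assert (Hc : Rabs c <= Rabs s * 1) by (apply Rabs_mult_le; [lra|apply Rabs_le; lra]).
  assert (Hal : Rabs al <= Rabs s * 1) by (apply Rabs_mult_le; [lra|apply Rabs_le; lra]).
  assert (Hsin : Rabs (sin al) <= Rabs s).
  { pose proof (sin_lipschitz al 0) as L. rewrite sin_0, !Rminus_0_r in L. lra. }
  assert (Hs2 : Rabs s * Rabs s = s ^ 2) by (rewrite <- (pow2_abs s); ring).
  assert (Hcos : Rabs (cos al - 1) <= s ^ 2).
  { pose proof (one_minus_cos_bound al). apply Rabs_le_sqr in Hal.
    apply Rabs_le. pose proof (pow2_ge_0 s). nra. }
  assert (HH : forall u v, Rabs u <= 1 -> Rabs v <= 1 ->
     (2 * (r0 * u) * (cos al - 1) + 2 * (v * (c * sin al))) *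
     (2 * (r0 * u) * (cos al - 1) + 2 * (v * (c * sin al)))
     <= (2 + 2 * Rabs r0) ^ 2 * (s ^ 2 * s ^ 2)).
  { intros u v Hu Hv.
    replace ((2 + 2 * Rabs r0) ^ 2 * (s ^ 2 * s ^ 2))
      with (((2 + 2 * Rabs r0) * s ^ 2) * ((2 + 2 * Rabs r0) * s ^ 2)) by ring.
    apply Rabs_le_sqr. eapply Rle_trans; [apply Rabs_triang|].
    assert (H2 : Rabs 2 <= 2) by (rewrite Rabs_pos_eq; lra).
    pose proof (Rabs_mult_le _ _ _ _ (Rabs_mult_le _ _ _ _ H2
       (Rabs_mult_le _ _ _ _ (Rle_refl (Rabs r0)) Hu)) Hcos).
    pose proof (Rabs_mult_le _ _ _ _ H2 (Rabs_mult_le _ _ _ _ Hv (Rabs_mult_le _ _ _ _ Hc Hsin))).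
    nra. }
  assert (Hcu : Rabs (cos P) <= 1) by (apply Rabs_le, COS_bound).
  assert (Hsu : Rabs (sin P) <= 1) by (apply Rabs_le, SIN_bound).
  pose proof (HH (cos P) (- sin P) Hcu ltac:(rewrite Rabs_Ropp; exact Hsu)).
  pose proof (HH (sin P) (cos P) Hsu Hcu).
  lra.
Qed.

(** The right-hand side equals [4 ((s cos th)^2 cos^2 al + r0^2 sin^2 al)] with [al = s sin th], and
    [|al| <= 1] gives [cos^2 al >= 1/4] and [sin^2 al >= al^2 / 4]. The factor degenerates with
    [r0], which is why [rs 0 <> 0] is needed later. *)
Lemma circle_antipodal_dist r0 P s th :
  0 < s <= 1 ->
  Rmin 1 (r0 ^ 2) * s ^ 2 <=
  (circle_x r0 P s th - circle_x r0 P (- s) th) * (circle_x r0 P s th - circle_x r0 P (- s) th) +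
  (circle_y r0 P s th - circle_y r0 P (- s) th) * (circle_y r0 P s th - circle_y r0 P (- s) th).
Proof.
  intros Hs. unfold circle_x, circle_y.
  replace (- s * cos th) with (- (s * cos th)) by ring.
  replace (P + - s * sin th) with (P - s * sin th) by ring.
  pose proof (COS_bound th). pose proof (SIN_bound th).
  set (al := s * sin th).
  assert (Hal : Rabs al <= 1).
  { rewrite <- (Rmult_1_r 1). apply Rabs_mult_le; apply Rabs_le; lra. }
  pose proof (sin_sqr_lower al Hal) as L1.
  pose proof (one_minus_cos_bound al) as L2.
  assert (L3 : al ^ 2 <= 1) by (rewrite <- pow2_abs; pose proof (Rabs_pos al); nra).
  rewrite cos_plus, cos_minus, sin_plus, sin_minus.
  match goal with |- _ <= ?e =>
    replace e with (4 * ((Rsqr (sin P) + Rsqr (cos P)) *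
                     ((s * cos th) ^ 2 * cos al ^ 2 + r0 ^ 2 * sin al ^ 2)))
      by (unfold Rsqr; ring) end.
  rewrite sin2_cos2, Rmult_1_l.
  pose proof (sin2_cos2 th) as SC. unfold Rsqr in SC.
  assert (L4 : 1 / 4 <= cos al ^ 2) by nra.
  pose proof (pow2_ge_0 r0) as HR. pose proof (pow2_ge_0 (s * cos th)) as Hsc.
  assert (M1 : (s * cos th) ^ 2 * (1 / 4) <= (s * cos th) ^ 2 * cos al ^ 2)
    by (apply Rmult_le_compat_l; assumption).
  assert (M2 : r0 ^ 2 * (al ^ 2 / 4) <= r0 ^ 2 * sin al ^ 2)
    by (apply Rmult_le_compat_l; assumption).
  assert (M3 : Rmin 1 (r0 ^ 2) * (s * cos th) ^ 2 <= 1 * (s * cos th) ^ 2)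
    by (apply Rmult_le_compat_r; [assumption|apply Rmin_l]).
  assert (M4 : Rmin 1 (r0 ^ 2) * al ^ 2 <= r0 ^ 2 * al ^ 2)
    by (apply Rmult_le_compat_r; [apply pow2_ge_0|apply Rmin_r]).
  assert (M5 : s ^ 2 = (s * cos th) ^ 2 + al ^ 2).
  { unfold al. transitivity (s ^ 2 * (sin th * sin th + cos th * cos th)); [rewrite SC|]; ring. }
  rewrite M5. lra.
Qed.

(** Makes the state at time [T] continuous in the angle of the data, although the solutions are
    selected pointwise. *)
Lemma continuity_of_sqr_bound (f g h : R -> R) G :
  0 < G -> continuity g -> continuity h ->
  (forall a b, (f a - f b) * (f a - f b) <=
     G * ((g a - g b) * (g a - g b) + (h a - h b) * (h a - h b))) ->
  continuity f.
Proof.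
  intros HG Cg Ch H b e He.
  set (w := fun a => G * ((g a - g b) * (g a - g b) + (h a - h b) * (h a - h b))).
  assert (Cw : continuity w).
  { unfold w. intros a. specialize (Cg a). specialize (Ch a). reg. }
  destruct (Cw b (e * e) ltac:(nra)) as [d [Hd Hw]].
  exists d; split; [exact Hd|]. intros a Ha. specialize (Hw a Ha).
  simpl in *. unfold Rdist in *.
  assert (w b = 0) by (unfold w; ring). rewrite H0, Rminus_0_r in Hw.
  apply Rabs_def2 in Hw. specialize (H a b). fold (w a) in H.
  rewrite <- (Rabs_pos_eq e) by lra. apply Rsqr_lt_abs_0. unfold Rsqr. lra.
Qed.

(* Of two displacements [z1 - z0], [z2 - z0] whose difference points along the
   diagonal of the rotated frame and whose sum is much shorter, one lies in the
   open positive quadrant. *)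
Lemma quadrant_of_diagonal a1 b1 a2 b2 :
  a1 - b1 = a2 - b2 ->
  2 * ((a1 + a2) * (a1 + a2) + (b1 + b2) * (b1 + b2)) <
    (a1 - a2) * (a1 - a2) + (b1 - b2) * (b1 - b2) ->
  (0 < a1 /\ 0 < b1) \/ (0 < a2 /\ 0 < b2).
Proof.
  intros H L.
  assert (D : b1 - b2 = a1 - a2) by lra. rewrite D in L.
  set (d := a1 - a2) in *.
  pose proof (Rle_0_sqr (a1 + a2)) as Qa. pose proof (Rle_0_sqr (b1 + b2)) as Qb.
  unfold Rsqr in Qa, Qb.
  assert (Ha : Rabs (a1 + a2) < Rabs d) by (apply Rsqr_lt_abs_0; unfold Rsqr; lra).
  assert (Hb : Rabs (b1 + b2) < Rabs d) by (apply Rsqr_lt_abs_0; unfold Rsqr; lra).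
  destruct (Rle_lt_dec 0 d) as [Hd|Hd].
  - rewrite (Rabs_pos_eq d) in Ha, Hb by lra.
    apply Rabs_def2 in Ha, Hb. left; unfold d in *; lra.
  - rewrite (Rabs_left d) in Ha, Hb by lra.
    apply Rabs_def2 in Ha, Hb. right; unfold d in *; lra.
Qed.

(** In the frame rotated by [ps] the displacement has components [rho cos (psi - ps) - rs] and
    [rho sin (psi - ps)]. The bound on [psi - ps] excludes negative [rho] and angles shifted by full
    turns. *)
Lemma polar_quadrant rho psi rs ps :
  0 < rs -> Rabs (psi - ps) < 1 ->
  0 < (rho * cos psi - rs * cos ps) * cos ps + (rho * sin psi - rs * sin ps) * sin ps ->
  0 < (rho * sin psi - rs * sin ps) * cos ps - (rho * cos psi - rs * cos ps) * sin ps ->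
  rs < rho /\ ps < psi.
Proof.
  intros Hrs Hp Ha Hb. pose proof (sin2_cos2 ps) as SC. unfold Rsqr in SC.
  assert (Ea : (rho * cos psi - rs * cos ps) * cos ps + (rho * sin psi - rs * sin ps) * sin ps
               = rho * cos (psi - ps) - rs).
  { rewrite cos_minus. transitivity (rho * (cos psi * cos ps + sin psi * sin ps)
      - rs * (sin ps * sin ps + cos ps * cos ps)); [ring|rewrite SC; ring]. }
  assert (Eb : (rho * sin psi - rs * sin ps) * cos ps - (rho * cos psi - rs * cos ps) * sin ps
               = rho * sin (psi - ps)) by (rewrite sin_minus; ring).
  rewrite Ea in Ha. rewrite Eb in Hb. apply Rabs_def2 in Hp.
  pose proof (one_minus_cos_bound (psi - ps)). pose proof PI2_1.
  assert (0 < cos (psi - ps)) by (apply cos_gt_0; lra).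
  assert (0 < rho) by nra. split; [nra|].
  destruct (Rlt_le_dec ps psi) as [L|L]; [exact L|].
  assert (0 <= sin (ps - psi)) by (apply sin_ge_0; lra).
  replace (psi - ps) with (- (ps - psi)) in Hb by ring. rewrite sin_neg in Hb. nra.
Qed.

(** At time [T] an antipodal pair is separated by at least a multiple of the radius [s], while its
    failure to be symmetric about the given solution is [O(s^2)]. All constants depend on [T] only
    through bounds fixed before [s], so a small [s] decides the comparison. *)
Lemma solution_in_quadrant lam nu mu rs ps T eps eta :
  cont_halfline mu -> MS_sol lam nu mu None rs ps -> 0 < T -> 0 < rs T -> rs 0 <> 0 ->
  0 < eps <= 1 -> 0 < eta ->
  (forall r0 p0, Rabs (r0 - rs 0) + Rabs (p0 - ps 0) < eta ->
     exists rho psi, MS_sol lam nu mu None rho psi /\ rho 0 = r0 /\ psi 0 = p0 /\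
       forall t, 0 <= t -> Rabs (rho t - rs t) + Rabs (psi t - ps t) < eps) ->
  exists rho psi, MS_sol lam nu mu None rho psi /\
    (forall t, 0 <= t -> Rabs (rho t - rs t) + Rabs (psi t - ps t) < eps) /\
    rs T < rho T /\ ps T < psi T.
Proof.
  intros Cmu Ss HT HrsT Hrs0 Heps Heta Hnear.
  destruct (MS_sol_cont _ _ _ _ _ Ss) as [Crs _].
  destruct (cont_halfline_bounded rs T Crs) as [B0 [HB0 Brs]]; [lra|].
  destruct (cont_halfline_bounded mu T Cmu) as [Mm [HMm Bmu]]; [lra|].
  set (B := B0 + 1).
  assert (Bnd : forall rho psi, MS_sol lam nu mu None rho psi ->
    (forall t, 0 <= t -> Rabs (rho t - rs t) + Rabs (psi t - ps t) < eps) ->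
    cart_sol lam nu mu (fun t => rho t * cos (psi t)) (fun t => rho t * sin (psi t)) /\
    bounded_on T B (fun t => rho t * cos (psi t)) /\
    bounded_on T B (fun t => rho t * sin (psi t))).
  { intros rho psi S Hst.
    assert (Br : forall t, 0 <= t <= T -> Rabs (rho t) <= B).
    { intros t Ht. specialize (Hst t ltac:(lra)). specialize (Brs t Ht).
      pose proof (Rabs_pos (psi t - ps t)).
      replace (rho t) with (rho t - rs t + rs t) by ring.
      eapply Rle_trans; [apply Rabs_triang|]. unfold B; lra. }
    split; [apply MS_cart; exact S|].
    split; intros t Ht; rewrite <- (Rmult_1_r B); apply Rabs_mult_le; auto;
      apply Rabs_le; [apply COS_bound|apply SIN_bound]. }
  assert (Hself : forall t, 0 <= t -> Rabs (rs t - rs t) + Rabs (ps t - ps t) < eps).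
  { intros t _. unfold Rminus; rewrite !Rplus_opp_r, Rabs_R0. lra. }
  destruct (Bnd rs ps Ss Hself) as [Z0 [Bx0 By0]].
  set (x0 := fun t => rs t * cos (ps t)) in *. set (y0 := fun t => rs t * sin (ps t)) in *.
  destruct (cart_second_diff_bound lam nu mu B Mm T ltac:(lra) Bmu) as [Q [HQ Second]].
  set (G := exp ((16 * (B * B) + 4 * Mm) * T)).
  assert (HG : 0 < G) by apply exp_pos.
  set (r0 := rs 0) in *. set (P := ps 0) in *.
  set (c0 := Rmin 1 (r0 ^ 2)).
  assert (Hc0 : 0 < c0) by (apply Rmin_glb_lt; [lra|rewrite <- Rsqr_pow2; apply Rsqr_pos_lt, Hrs0]).
  set (k1 := 2 * (1 + Rabs r0) ^ 2). set (k2 := 2 * (2 + 2 * Rabs r0) ^ 2).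
  assert (Hk1 : 0 < k1) by (pose proof (Rabs_pos r0); unfold k1; assert (0 < (1 + Rabs r0) ^ 2) by (apply pow_lt; lra); lra).
  assert (Hk2 : 0 < k2) by (pose proof (Rabs_pos r0); unfold k2; assert (0 < (2 + 2 * Rabs r0) ^ 2) by (apply pow_lt; lra); lra).
  set (k3 := Q * (k2 + k1 * k1)).
  assert (Hk3 : 0 < k3) by (apply Rmult_lt_0_compat; [|pose proof (Rmult_lt_0_compat _ _ Hk1 Hk1)]; lra).
  (* The bound 1 is for [circle_antipodal_dist]; [eta / 3] keeps the data admissible, as they move
     by at most [2 * s] in total; the last bound makes the squared asymmetry [k3 * s^4] small
     against the squared separation [c0 * s^2 / G]. *)
  set (s := Rmin (Rmin 1 (eta / 3)) (c0 / (4 * G * k3))).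
  assert (Hs : 0 < s /\ s <= 1 /\ s <= eta / 3 /\ s <= c0 / (4 * G * k3)).
  { assert (0 < c0 / (4 * G * k3)).
    { apply Rdiv_lt_0_compat; [exact Hc0|repeat (lra || apply Rmult_lt_0_compat)]. }
    pose proof (Rmin_l (Rmin 1 (eta / 3)) (c0 / (4 * G * k3))).
    pose proof (Rmin_r (Rmin 1 (eta / 3)) (c0 / (4 * G * k3))).
    pose proof (Rmin_l 1 (eta / 3)). pose proof (Rmin_r 1 (eta / 3)).
    unfold s. repeat split; try lra. repeat apply Rmin_glb_lt; lra. }
  destruct Hs as [Hs0 [Hs1 [Hs2 Hs3]]].
  assert (Hflow : forall z : bool * R, exists w : (R -> R) * (R -> R),
    let e := if fst z then s else - s in
    MS_sol lam nu mu None (fst w) (snd w) /\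
    fst w 0 = r0 + e * cos (snd z) /\ snd w 0 = P + e * sin (snd z) /\
    forall t, 0 <= t -> Rabs (fst w t - rs t) + Rabs (snd w t - ps t) < eps).
  { intros [b th]. simpl. set (e := if b then s else - s).
    assert (He : Rabs e <= s) by (apply Rabs_le; unfold e; destruct b; lra).
    destruct (Hnear (r0 + e * cos th) (P + e * sin th)) as [rho [psi H]].
    - fold r0 P. replace (r0 + e * cos th - r0) with (e * cos th) by ring.
      replace (P + e * sin th - P) with (e * sin th) by ring.
      pose proof (Rabs_mult_le _ _ _ _ He (Rabs_le _ _ (COS_bound th))).
      pose proof (Rabs_mult_le _ _ _ _ He (Rabs_le _ _ (SIN_bound th))). rewrite Rmult_1_r in *; lra.
    - exists (rho, psi). exact H. }
  apply functional_choice in Hflow. destruct Hflow as [F HF].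
  set (X := fun b th t => fst (F (b, th)) t * cos (snd (F (b, th)) t)).
  set (Y := fun b th t => fst (F (b, th)) t * sin (snd (F (b, th)) t)).
  set (sg := fun b : bool => if b then s else - s).
  assert (HZ : forall b th, cart_sol lam nu mu (X b th) (Y b th) /\
                 bounded_on T B (X b th) /\ bounded_on T B (Y b th)).
  { intros b th. destruct (HF (b, th)) as [S [_ [_ H]]]. exact (Bnd _ _ S H). }
  assert (HX0 : forall b th, X b th 0 = circle_x r0 P (sg b) th).
  { intros b th. destruct (HF (b, th)) as [_ [E1 [E2 _]]].
    unfold X. rewrite E1, E2. reflexivity. }
  assert (HY0 : forall b th, Y b th 0 = circle_y r0 P (sg b) th).
  { intros b th. destruct (HF (b, th)) as [_ [E1 [E2 _]]].
    unfold Y. rewrite E1, E2. reflexivity. }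
  assert (Dist : forall b th b' th',
    sqdist (X b th) (Y b th) (X b' th') (Y b' th') T <=
      sqdist (X b th) (Y b th) (X b' th') (Y b' th') 0 * G /\
    sqdist (X b th) (Y b th) (X b' th') (Y b' th') 0 <=
      sqdist (X b th) (Y b th) (X b' th') (Y b' th') T * G).
  { intros b th b' th'.
    destruct (HZ b th) as [S [Bx By]]. destruct (HZ b' th') as [S' [Bx' By']].
    apply cart_dist_bounds with (lam := lam) (nu := nu) (mu := mu) (T := T); auto; lra. }
  assert (Ccx : forall e, continuity (circle_x r0 P e)) by (intros; unfold circle_x; reg).
  assert (Ccy : forall e, continuity (circle_y r0 P e)) by (intros; unfold circle_y; reg).
  assert (CX : forall b, continuity (fun th => X b th T)).
  { intros b. apply (continuity_of_sqr_bound _ _ _ G HG (Ccx (sg b)) (Ccy (sg b))).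
    intros th th'. destruct (Dist b th b th') as [D _].
    unfold sqdist in D. rewrite !HX0, !HY0 in D.
    pose proof (Rle_0_sqr (Y b th T - Y b th' T)) as N. unfold Rsqr in N. lra. }
  assert (CY : forall b, continuity (fun th => Y b th T)).
  { intros b. apply (continuity_of_sqr_bound _ _ _ G HG (Ccx (sg b)) (Ccy (sg b))).
    intros th th'. destruct (Dist b th b th') as [D _].
    unfold sqdist in D. rewrite !HX0, !HY0 in D.
    pose proof (Rle_0_sqr (X b th T - X b th' T)) as N. unfold Rsqr in N. lra. }
  set (ca := cos (ps T)). set (sa := sin (ps T)).
  (* [h] is the difference of the two rotated components of the vector joining the antipodal states,
     so its zeros are the diagonal positions. *)
  set (h := fun th => (X true th T - X false th T) * (ca + sa)
                      + (Y true th T - Y false th T) * (sa - ca)).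
  assert (Ch : continuity h).
  { unfold h. intros th. pose proof (CX true th). pose proof (CX false th).
    pose proof (CY true th). pose proof (CY false th).
    apply continuity_pt_plus; apply continuity_pt_mult;
      try apply continuity_pt_minus; try assumption; apply continuity_const; intros ? ?; reflexivity. }
  (* A half turn exchanges the data of the pair; by the upper distance bound equal data have equal
     Cartesian states at [T], so [h PI = - h 0]. *)
  assert (Same : forall b, X b PI T = X (negb b) 0 T /\ Y b PI T = Y (negb b) 0 T).
  { intros b. destruct (Dist b PI (negb b) 0) as [D _].
    assert (Z : sqdist (X b PI) (Y b PI) (X (negb b) 0) (Y (negb b) 0) 0 = 0).
    { unfold sqdist. rewrite !HX0, !HY0. unfold circle_x, circle_y, sg.
      rewrite cos_PI, sin_PI, cos_0, sin_0, !Rmult_0_r. destruct b; simpl; ring. }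
    rewrite Z, Rmult_0_l in D. unfold sqdist in D.
    pose proof (Rle_0_sqr (X b PI T - X (negb b) 0 T)) as N1.
    pose proof (Rle_0_sqr (Y b PI T - Y (negb b) 0 T)) as N2. unfold Rsqr in N1, N2.
    split; apply Rminus_diag_uniq, Rsqr_0_uniq; unfold Rsqr; lra. }
  destruct (IVT_cor h 0 PI Ch) as [th [_ Hth]].
  { pose proof PI_RGT_0; lra. }
  { destruct (Same true) as [E1 E2]. destruct (Same false) as [E3 E4]. simpl in *.
    replace (h PI) with (- h 0) by (unfold h; rewrite E1, E2, E3, E4; ring).
    pose proof (Rle_0_sqr (h 0)) as N. unfold Rsqr in N. lra. }
  set (a := fun b => (X b th T - x0 T) * ca + (Y b th T - y0 T) * sa).
  set (bb := fun b => (Y b th T - y0 T) * ca - (X b th T - x0 T) * sa).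
  assert (SC : sa * sa + ca * ca = 1) by (pose proof (sin2_cos2 (ps T)) as E; exact E).
  assert (Quad : (0 < a true /\ 0 < bb true) \/ (0 < a false /\ 0 < bb false)).
  { apply quadrant_of_diagonal.
    - unfold h in Hth. unfold a, bb. lra.
    - destruct (HZ true th) as [S1 [Bx1 By1]]. destruct (HZ false th) as [S2 [Bx2 By2]].
      assert (E : forall b, sqdist (X b th) (Y b th) x0 y0 0 <= k1 * s ^ 2).
      { intros b. unfold sqdist. rewrite HX0, HY0.
        replace (s ^ 2) with (sg b ^ 2) by (unfold sg; destruct b; ring).
        apply circle_dist. }
      assert (N := Second x0 y0 (X true th) (Y true th) (X false th) (Y false th) _
                     Z0 S1 S2 Bx0 By0 Bx1 By1 Bx2 By2 (E true) (E false)).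
      assert (N0 := circle_antipodal_mean r0 P s th).
      fold k2 in N0.
      assert (N1 : sqdist (fun t => X true th t + X false th t) (fun t => Y true th t + Y false th t)
           (fun t => 2 * x0 t) (fun t => 2 * y0 t) T <= k3 * (s ^ 2 * s ^ 2)).
      { eapply Rle_trans; [exact N|]. unfold k3.
        replace (Q * (k2 + k1 * k1) * (s ^ 2 * s ^ 2))
          with (Q * ((k2 + k1 * k1) * (s ^ 2 * s ^ 2))) by ring.
        apply Rmult_le_compat_l; [lra|]. unfold sqdist. rewrite !HX0, !HY0.
        unfold sg, x0, y0. fold r0 P. lra. }
      destruct (Dist true th false th) as [_ D].
      assert (D0 := circle_antipodal_dist r0 P s th (conj Hs0 Hs1)). fold c0 in D0.
      assert (D1 : c0 * s ^ 2 <= sqdist (X true th) (Y true th) (X false th) (Y false th) T * G).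
      { eapply Rle_trans; [|exact D]. unfold sqdist. rewrite !HX0, !HY0. exact D0. }
      assert (EN : (a true + a false) * (a true + a false) + (bb true + bb false) * (bb true + bb false)
         = sqdist (fun t => X true th t + X false th t) (fun t => Y true th t + Y false th t)
           (fun t => 2 * x0 t) (fun t => 2 * y0 t) T).
      { rewrite <- (Rmult_1_r (sqdist _ _ _ _ T)), <- SC. unfold sqdist, a, bb. ring. }
      assert (ED : (a true - a false) * (a true - a false) + (bb true - bb false) * (bb true - bb false)
         = sqdist (X true th) (Y true th) (X false th) (Y false th) T).
      { rewrite <- (Rmult_1_r (sqdist _ _ _ _ T)), <- SC. unfold sqdist, a, bb. ring. }
      rewrite EN, ED. clear EN ED.
      apply (Rmult_lt_reg_r G); [exact HG|].
      eapply Rlt_le_trans; [|exact D1].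
      assert (Hsk : 4 * G * k3 * s <= c0).
      { assert (0 < 4 * G * k3) by (repeat (lra || apply Rmult_lt_0_compat)).
        replace c0 with (4 * G * k3 * (c0 / (4 * G * k3))) by (field; lra).
        apply Rmult_le_compat_l; lra. }
      assert (Hss : 0 < s ^ 2) by nra.
      (* One factor [s] is given away through [s^2 <= s]; the other is paired with [4 * G * k3] to
         be bounded by [c0]. *)
      assert (W1 : 2 * (k3 * (s ^ 2 * s ^ 2)) * G <= (4 * G * k3 * s) * s ^ 2 / 2).
      { assert (0 < G * k3 * s ^ 2) by (repeat (lra || apply Rmult_lt_0_compat)).
        assert (s ^ 2 <= s) by nra.
        replace (2 * (k3 * (s ^ 2 * s ^ 2)) * G) with (2 * (G * k3 * s ^ 2) * s ^ 2) by ring.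
        replace (4 * G * k3 * s * s ^ 2 / 2) with (2 * (G * k3 * s ^ 2) * s) by field.
        apply Rmult_le_compat_l; lra. }
      assert (W2 : 4 * G * k3 * s * s ^ 2 <= c0 * s ^ 2) by (apply Rmult_le_compat_r; lra).
      assert (W3 : 0 < c0 * s ^ 2) by (apply Rmult_lt_0_compat; lra).
      match goal with |- 2 * ?n * G < _ =>
        assert (2 * n * G <= 2 * (k3 * (s ^ 2 * s ^ 2)) * G)
          by (apply Rmult_le_compat_r; lra) end.
      lra. }
  assert (Fin : forall b, 0 < a b -> 0 < bb b ->
    exists rho psi, MS_sol lam nu mu None rho psi /\
    (forall t, 0 <= t -> Rabs (rho t - rs t) + Rabs (psi t - ps t) < eps) /\
    rs T < rho T /\ ps T < psi T).
  { intros b Ha Hb. destruct (HF (b, th)) as [S [_ [_ Hst]]].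
    exists (fst (F (b, th))), (snd (F (b, th))). split; [exact S|]. split; [exact Hst|].
    apply polar_quadrant; [exact HrsT| |exact Ha|exact Hb].
    specialize (Hst T ltac:(lra)). pose proof (Rabs_pos (fst (F (b, th)) T - rs T)). lra. }
  destruct Quad as [[Ha Hb]|[Ha Hb]]; [exact (Fin true Ha Hb)|exact (Fin false Ha Hb)].
Qed.

(** Separates the dynamics from the asymptotics: beyond the sizes of [rs] and [mu], the expansion is
    encoded as a one-sided difference estimate for increments [0 <= p <= eps], that is, only above
    [ps]. *)
Lemma unstable_of_expanding_sector lam nu mu rs ps a C c k eps T :
  cont_halfline mu -> MS_sol lam nu mu None rs ps ->
  0 < T -> 0 < a -> 0 < C -> 0 < k -> k <= a -> k <= c ->
  1 <= a * sqrt T -> 3 * C + / a <= k * sqrt T ->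
  (forall t, T <= t -> a * sqrt t <= rs t) ->
  (forall t, T <= t -> Rabs (mu t) * sqrt t <= C) ->
  0 < eps <= 1 ->
  (forall t p, T <= t -> 0 <= p <= eps ->
     c * p <= sqrt t * (sin (ps t + p) - sin (ps t)
        - mu t * rs t * (sin (2 * (ps t + p) + nu) - sin (2 * ps t + nu)))) ->
  lyap_unstable lam nu mu rs ps.
Proof.
  intros Cmu Ss HT Ha HC Hk Hka Hkc HaT HkT Hrs Hmu Heps HG Hst.
  pose proof (stable_rho0_neq0 _ _ _ _ _ Cmu Hst) as Hrs0.
  destruct (Hst eps (proj1 Heps)) as [eta [Heta H]].
  destruct (solution_in_quadrant lam nu mu rs ps T eps eta) as [rho [psi [S [Hn [Hr Hp]]]]]; auto.
  - specialize (Hrs T (Rle_refl _)). lra.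
  - intros r0 p0 H0. destruct (H r0 p0 H0) as [[rho [psi [S [E1 E2]]]] HH].
    exists rho, psi. repeat split; try assumption; try apply S.
    intros t Ht. apply (HH None rho psi S E1 E2 t). split; [exact Ht|exact I].
  - apply (quadrant_escape lam nu mu rs ps rho psi a C c k eps T); auto.
    intros t Ht. apply Hn. lra.
Qed.

(** * Asymptotics *)

Lemma derivable_pt_lim_affine nu s : derivable_pt_lim (fun u => 2 * u + nu) s 2.
Proof.
  pose proof (derivable_pt_lim_plus _ _ _ _ _ (derivable_pt_lim_linear 2 s)
                (derivable_pt_lim_const nu s)) as H.
  rewrite Rplus_0_r in H. exact H.
Qed.

Lemma derivable_pt_lim_sin_affine nu s :
  derivable_pt_lim (fun u => sin (2 * u + nu)) s (cos (2 * s + nu) * 2).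
Proof.
  apply (derivable_pt_lim_comp (fun u => 2 * u + nu) sin);
    [apply derivable_pt_lim_affine|apply derivable_pt_lim_sin].
Qed.

Lemma derivable_pt_lim_cos_affine nu s :
  derivable_pt_lim (fun u => cos (2 * u + nu)) s (- sin (2 * s + nu) * 2).
Proof.
  apply (derivable_pt_lim_comp (fun u => 2 * u + nu) cos);
    [apply derivable_pt_lim_affine|apply derivable_pt_lim_cos].
Qed.

Lemma Pf_derive delta nu s : derivable_pt_lim (fun u => Pf u delta nu) s (Pf1 s delta nu).
Proof.
  replace (Pf1 s delta nu) with (delta * (cos (2 * s + nu) * 2) - cos s) by (unfold Pf1; ring).
  exact (derivable_pt_lim_minus _ _ _ _ _
    (derivable_pt_lim_scal _ delta _ _ (derivable_pt_lim_sin_affine nu s))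
    (derivable_pt_lim_sin s)).
Qed.

Lemma Pf1_derive delta nu s : derivable_pt_lim (fun u => Pf1 u delta nu) s (Pf2 s delta nu).
Proof.
  replace (Pf2 s delta nu) with (2 * delta * (- sin (2 * s + nu) * 2) - - sin s)
    by (unfold Pf2; ring).
  exact (derivable_pt_lim_minus _ _ _ _ _
    (derivable_pt_lim_scal _ (2 * delta) _ _ (derivable_pt_lim_cos_affine nu s))
    (derivable_pt_lim_cos s)).
Qed.

Lemma Pf2_derive delta nu s : derivable_pt_lim (fun u => Pf2 u delta nu) s (Pf3 s delta nu).
Proof.
  replace (Pf3 s delta nu) with (- (4 * delta * (cos (2 * s + nu) * 2)) + cos s)
    by (unfold Pf3; ring).
  exact (derivable_pt_lim_plus _ _ _ _ _
    (derivable_pt_lim_opp _ _ _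
      (derivable_pt_lim_scal _ (4 * delta) _ _ (derivable_pt_lim_sin_affine nu s)))
    (derivable_pt_lim_sin s)).
Qed.

Lemma Pf3_continuous delta nu : continuity (fun u => Pf3 u delta nu).
Proof. unfold Pf3. reg. Qed.

Lemma continuity_pt_neg_near f s :
  continuity_pt f s -> f s < 0 ->
  exists k e, 0 < k /\ 0 < e /\ forall x, Rabs (x - s) < e -> f x <= - k.
Proof.
  intros Hf Hs. destruct (Hf (- f s / 2) ltac:(lra)) as [e [He H]].
  exists (- f s / 2), e. split; [lra|split; [exact He|]]. intros x Hx.
  destruct (Req_dec x s) as [->|N]; [lra|].
  specialize (H x). simpl in H. unfold Rdist in H.
  assert (L : Rabs (f x - f s) < - f s / 2)
    by (apply H; split; [split; [exact I|auto]|exact Hx]).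
  apply Rabs_def2 in L. lra.
Qed.

Lemma Rpower_unbounded e A :
  0 < e -> exists M, 1 <= M /\ forall t, M <= t -> A <= Rpower t e.
Proof.
  intros He. exists (Rmax 1 (exp (A / e))). split; [apply Rmax_l|]. intros t Ht.
  pose proof (Rmax_l 1 (exp (A / e))). pose proof (Rmax_r 1 (exp (A / e))).
  assert (L : A / e <= ln t).
  { rewrite <- (ln_exp (A / e)). pose proof (exp_pos (A / e)).
    destruct (Rle_lt_or_eq_dec (exp (A / e)) t) as [L|L]; [lra|left; apply ln_increasing; lra|].
    rewrite L. right; reflexivity. }
  assert (A <= e * ln t).
  { replace A with (e * (A / e)) by (field; lra). apply Rmult_le_compat_l; lra. }
  unfold Rpower. pose proof (exp_ineq1_le (e * ln t)). lra.
Qed.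

Lemma asymp_vanishing f a c q eps :
  asymp f (fun t => a t) 0 c q -> 0 < q -> 0 < eps ->
  exists M, 1 <= M /\ forall t, M <= t -> Rabs (f t - a t) <= eps.
Proof.
  (* The truncation of order 0 has an empty partial sum and error [C * t^(-q)]; the sign of [C] is
     unknown, hence [Rabs C]. *)
  intros H Hq He. destruct (H O) as [C [M [HM HC]]].
  destruct (Rpower_unbounded q (Rabs C / eps) Hq) as [M' [HM' HR]].
  exists (Rmax M M'). pose proof (Rmax_l M M'). pose proof (Rmax_r M M').
  split; [lra|]. intros t Ht. specialize (HC t ltac:(lra)). specialize (HR t ltac:(lra)).
  simpl psum in HC. rewrite Rminus_0_r in HC.
  replace (0 - INR 1 * q) with (- q) in HC by (simpl; ring).
  rewrite Rpower_Ropp in HC. apply Rle_trans with (1 := HC).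
  assert (P : 0 < Rpower t q) by apply exp_pos.
  apply (Rmult_le_reg_r (Rpower t q)); [exact P|].
  rewrite Rmult_assoc, Rinv_l, Rmult_1_r by lra.
  apply Rle_trans with (1 := Rle_abs C).
  replace (Rabs C) with (eps * (Rabs C / eps)) by (field; lra).
  apply Rmult_le_compat_l; lra.
Qed.

(** The truncation of order 1 leaves an error [O(t^(-2 q))], which eventually eats at most half of
    the first term. *)
Lemma asymp_first_coef_pos f a c q :
  asymp f (fun _ => a) 0 c q -> 0 < q -> 0 < c 1%nat ->
  exists M, 1 <= M /\ forall t, M <= t -> c 1%nat / 2 * Rpower t (- q) <= f t - a.
Proof.
  intros H Hq Hc. destruct (H 1%nat) as [C [M [HM HC]]].
  destruct (Rpower_unbounded q (2 * Rabs C / c 1%nat) Hq) as [M' [HM' HR]].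
  exists (Rmax M M'). pose proof (Rmax_l M M'). pose proof (Rmax_r M M').
  split; [lra|]. intros t Ht. specialize (HC t ltac:(lra)). specialize (HR t ltac:(lra)).
  set (w := Rpower t (- q)) in *.
  assert (Hw : 0 < w) by apply exp_pos.
  simpl psum in HC.
  replace (0 - 1 * q) with (- q) in HC by ring. fold w in HC.
  replace (0 - INR 2 * q) with (- q + - q) in HC by (simpl; ring).
  rewrite Rpower_plus in HC. fold w in HC.
  assert (W : w * Rpower t q = 1).
  { unfold w. rewrite <- Rpower_plus. replace (- q + q) with 0 by ring.
    apply Rpower_O. lra. }
  assert (L : C * w <= c 1%nat / 2).
  { apply Rle_trans with (Rabs C * w); [apply Rmult_le_compat_r; [lra|apply Rle_abs]|].
    replace (c 1%nat / 2) with (c 1%nat / 2 * (Rpower t q * w)) by (rewrite (Rmult_comm _ w), W; ring).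
    rewrite <- Rmult_assoc. apply Rmult_le_compat_r; [lra|].
    replace (Rabs C) with (c 1%nat / 2 * (2 * Rabs C / c 1%nat)) by (field; lra).
    apply Rmult_le_compat_l; lra. }
  apply Rabs_le_inv in HC.
  pose proof (Rmult_le_compat_r w _ _ (Rlt_le _ _ Hw) L). lra.
Qed.

Lemma Rpower_half t : 0 < t -> Rpower t (1 / 2) = sqrt t.
Proof. intros Ht. replace (1 / 2) with (/ 2) by field. apply Rpower_sqrt, Ht. Qed.

Lemma mu_expansion_leading mu muc :
  mu_expansion mu muc ->
  exists C M, 0 < C /\ 1 <= M /\
    forall t, M <= t -> Rabs (mu t * sqrt t - muc O) * sqrt t <= C.
Proof.
  intros H. destruct (H O) as [C [M [HM HC]]].
  exists (Rabs C + 1), (Rmax 1 M). pose proof (Rabs_pos C).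
  split; [lra|split; [apply Rmax_l|]]. intros t Ht.
  pose proof (Rmax_l 1 M). pose proof (Rmax_r 1 M). specialize (HC t ltac:(lra)).
  simpl psum in HC. rewrite Rminus_0_r in HC.
  replace (- (1 / 2) - INR 1 * 1) with (- (1 / 2) + Ropp 1) in HC by (simpl; ring).
  rewrite Rpower_plus, !Rpower_Ropp, Rpower_half, Rpower_1 in HC by lra.
  assert (Hs : 1 <= sqrt t) by (rewrite <- sqrt_1; apply sqrt_le_1; lra).
  assert (Ht' : t = sqrt t * sqrt t) by (rewrite sqrt_sqrt; lra).
  set (q := sqrt t) in *.
  replace (mu t * q - muc O) with ((mu t - muc O * / q) * q) by (field; lra).
  rewrite Rabs_mult, (Rabs_pos_eq q), Rmult_assoc by lra.
  apply Rle_trans with (C * (/ q * / t) * (q * q)).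
  { apply Rmult_le_compat_r; [nra|exact HC]. }
  replace (C * (/ q * / t) * (q * q)) with (C * / q) by (rewrite Ht'; field; lra).
  apply Rle_trans with (Rabs C * 1); [|lra].
  apply Rle_trans with (1 := Rle_abs _). rewrite Rabs_mult.
  apply Rmult_le_compat_l; [lra|]. rewrite Rabs_pos_eq.
  - rewrite <- Rinv_1. apply Rinv_le_contravar; lra.
  - left; apply Rinv_0_lt_compat; lra.
Qed.

(** With [delta = m0 * l], the true slope differs from that of [- Pf] by [mu * rs - delta]. Times
    [sqrt t], this splits into [mu sqrt t (rs - l sqrt t)] and [l (mu sqrt t - m0) sqrt t], both
    bounded; a slope of [- Pf] beyond every multiple of [t^(-1/2)] therefore survives. *)
Lemma unstable_of_slope lam nu mu muc rs ps rc q eps :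
  0 < lam -> cont_halfline mu -> mu_expansion mu muc ->
  MS_sol lam nu mu None rs ps ->
  asymp rs (fun t => sqrt lam * Rpower t (1 / 2)) 0 rc q -> 0 < q -> 0 < eps ->
  (forall A, exists M, forall t xi, M <= t -> ps t <= xi <= ps t + eps ->
     A <= sqrt t * - Pf1 xi (muc O * sqrt lam) nu) ->
  lyap_unstable lam nu mu rs ps.
Proof.
  intros Hlam Cmu Hmu Ss Hrs Hq Heps HP.
  destruct (mu_expansion_leading mu muc Hmu) as [C1 [M1 [HC1 [HM1 Bmu]]]].
  destruct (asymp_vanishing _ _ _ _ 1 Hrs Hq Rlt_0_1) as [M2 [HM2 Brs]].
  set (l := sqrt lam) in *. assert (Hl : 0 < l) by (apply sqrt_lt_R0, Hlam).
  set (m0 := muc O) in *.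
  set (C := Rabs m0 + C1). assert (HC : 0 < C) by (pose proof (Rabs_pos m0); unfold C; lra).
  set (K := C + C1 * l).
  (* [2 * K] pays for the error [K] times [|D| <= 2 * p]; the remaining 1 is the constant [c]. *)
  destruct (HP (2 * K + 1)) as [M3 HP3].
  set (a := l / 2). set (k := Rmin a 1).
  assert (Hk : 0 < k) by (apply Rmin_glb_lt; unfold a; lra).
  assert (Hka : k <= a) by apply Rmin_l. assert (Hk1 : k <= 1) by apply Rmin_r.
  assert (Ha : 0 < a) by (unfold a; lra).
  assert (HD : 0 < (3 * C + / a) / k).
  { apply Rdiv_lt_0_compat; [|exact Hk]. pose proof (Rinv_0_lt_compat a Ha). lra. }
  (* The first summand makes [a * sqrt T >= 1], the second meets the threshold of
     [hyperbolic_growth]. *)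
  set (q0 := 2 / l + (3 * C + / a) / k).
  assert (Hl2 : 0 < 2 / l) by (apply Rdiv_lt_0_compat; lra).
  set (T := Rmax (Rmax M1 M2) (Rmax M3 (q0 * q0))).
  assert (HT : M1 <= T /\ M2 <= T /\ M3 <= T /\ q0 * q0 <= T).
  { pose proof (Rmax_l (Rmax M1 M2) (Rmax M3 (q0 * q0))).
    pose proof (Rmax_r (Rmax M1 M2) (Rmax M3 (q0 * q0))).
    pose proof (Rmax_l M1 M2). pose proof (Rmax_r M1 M2).
    pose proof (Rmax_l M3 (q0 * q0)). pose proof (Rmax_r M3 (q0 * q0)). unfold T. lra. }
  assert (Hq0 : forall t, T <= t -> q0 <= sqrt t).
  { intros t Ht. rewrite <- (sqrt_square q0) by (unfold q0; lra).
    apply sqrt_le_1; nra. }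
  assert (Hqt : forall t, T <= t -> 0 < sqrt t) by (intros; apply sqrt_lt_R0; lra).
  assert (Hu : forall t, T <= t -> Rabs (mu t * sqrt t) <= C /\
                 Rabs (mu t * sqrt t - m0) * sqrt t <= C1).
  { intros t Ht. specialize (Bmu t ltac:(lra)). split; [|exact Bmu].
    assert (1 <= sqrt t) by (rewrite <- sqrt_1; apply sqrt_le_1; lra).
    pose proof (Rabs_pos (mu t * sqrt t - m0)).
    replace (mu t * sqrt t) with (m0 + (mu t * sqrt t - m0)) by ring.
    eapply Rle_trans; [apply Rabs_triang|]. unfold C. nra. }
  assert (Hr : forall t, T <= t -> Rabs (rs t - l * sqrt t) <= 1).
  { intros t Ht. specialize (Brs t ltac:(lra)). simpl in Brs.
    rewrite Rpower_half in Brs by lra. exact Brs. }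
  apply (unstable_of_expanding_sector lam nu mu rs ps a C 1 k (Rmin eps 1) T); auto.
  - lra.
  - specialize (Hq0 T (Rle_refl T)).
    replace 1 with (a * (2 / l)) by (unfold a; field; lra).
    apply Rmult_le_compat_l; [lra|]. unfold q0 in Hq0; lra.
  - specialize (Hq0 T (Rle_refl T)).
    replace (3 * C + / a) with (k * ((3 * C + / a) / k)) by (field; lra).
    apply Rmult_le_compat_l; [lra|]. unfold q0 in Hq0; lra.
  - intros t Ht. specialize (Hr t Ht). specialize (Hq0 t Ht). apply Rabs_le_inv in Hr.
    assert (1 <= a * sqrt t).
    { replace 1 with (a * (2 / l)) by (unfold a; field; lra).
      apply Rmult_le_compat_l; [lra|]. unfold q0 in Hq0; lra. }
    unfold a in *. lra.
  - intros t Ht. specialize (Hqt t Ht). rewrite <- (Rabs_pos_eq (sqrt t)) by lra.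
    rewrite <- Rabs_mult. apply Hu, Ht.
  - split; [apply Rmin_glb_lt; lra|apply Rmin_r].
  - intros t p Ht Hp. destruct (Req_dec p 0) as [->|Np].
    { rewrite !Rplus_0_r. lra. }
    pose proof (Rmin_l eps 1).
    set (de := m0 * l) in *. specialize (Hqt t Ht).
    destruct (MVT_cor2 (fun u => Pf u de nu) (fun u => Pf1 u de nu) (ps t) (ps t + p))
      as [xi [E Hxi]]; [lra|intros; apply Pf_derive|].
    specialize (HP3 t xi ltac:(lra) ltac:(lra)).
    destruct (Hu t Ht) as [U1 U2]. specialize (Hr t Ht).
    set (D := sin (2 * (ps t + p) + nu) - sin (2 * ps t + nu)).
    assert (HDp : Rabs D <= 2 * p).
    { eapply Rle_trans; [apply sin_lipschitz|].
      replace (2 * (ps t + p) + nu - (2 * ps t + nu)) with (2 * p) by ring.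
      rewrite Rabs_pos_eq; lra. }
    assert (HK : Rabs (mu t * sqrt t * rs t - de * sqrt t) <= K).
    { replace (mu t * sqrt t * rs t - de * sqrt t)
        with (mu t * sqrt t * (rs t - l * sqrt t) + (mu t * sqrt t - m0) * sqrt t * l)
        by (unfold de; ring).
      eapply Rle_trans; [apply Rabs_triang|].
      pose proof (Rabs_mult_le _ _ _ _ U1 Hr).
      assert (Rabs ((mu t * sqrt t - m0) * sqrt t * l) <= C1 * l).
      { apply Rabs_mult_le; [|rewrite Rabs_pos_eq; lra].
        rewrite Rabs_mult, (Rabs_pos_eq (sqrt t)) by lra. exact U2. }
      unfold K. lra. }
    pose proof (Rabs_mult_le _ _ _ _ HK HDp) as HKD. apply Rabs_le_inv in HKD.
    assert (HM := Rmult_le_compat_r p _ _ (proj1 Hp) HP3).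
    replace (sqrt t * - Pf1 xi de nu * p) with (sqrt t * (Pf (ps t) de nu - Pf (ps t + p) de nu))
      in HM by (rewrite <- (Ropp_minus_distr (Pf (ps t + p) de nu)), E; ring).
    replace (Pf (ps t) de nu - Pf (ps t + p) de nu)
      with (sin (ps t + p) - sin (ps t) - de * D) in HM by (unfold Pf, D; ring).
    fold D. lra.
Qed.

(* Covers the degenerate roots, where [f = Pf1] vanishes to order [m] at [sigma]. *)
Lemma slope_of_degenerate_root f ps pc sigma q m k e :
  asymp ps (fun _ => sigma) 0 pc q -> 0 < q -> 0 < pc 1%nat -> INR m * q < 1 / 2 ->
  0 < k -> 0 < e ->
  (forall xi, sigma < xi < sigma + e -> k * (xi - sigma) ^ m <= - f xi) ->
  forall A, exists M, forall t xi, M <= t -> ps t <= xi <= ps t + e / 3 ->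
     A <= sqrt t * - f xi.
Proof.
  intros Has Hq Hpc Hm Hk He Hf A.
  (* [ps] within [e / 3] of [sigma] and [xi] within [e / 3] of [ps] keep [xi] below [sigma + e]; the
     first coefficient keeps it above [sigma]. *)
  destruct (asymp_vanishing _ _ _ _ (e / 3) Has Hq ltac:(lra)) as [M1 [HM1 H1]].
  destruct (asymp_first_coef_pos _ _ _ _ Has Hq Hpc) as [M2 [HM2 H2]].
  set (g := pc 1%nat / 2) in *. assert (Hg : 0 < g) by (unfold g; lra).
  assert (Hgm : 0 < k * g ^ m) by (apply Rmult_lt_0_compat; [exact Hk|apply pow_lt, Hg]).
  destruct (Rpower_unbounded (1 / 2 - INR m * q) (A / (k * g ^ m)) ltac:(lra)) as [M3 [HM3 H3]].
  exists (Rmax M1 (Rmax M2 M3)). intros t xi Ht Hxi.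
  pose proof (Rmax_l M1 (Rmax M2 M3)). pose proof (Rmax_r M1 (Rmax M2 M3)).
  pose proof (Rmax_l M2 M3). pose proof (Rmax_r M2 M3).
  specialize (H1 t ltac:(lra)). specialize (H2 t ltac:(lra)). specialize (H3 t ltac:(lra)).
  apply Rabs_le_inv in H1.
  assert (Hw : 0 < Rpower t (- q)) by apply exp_pos.
  assert (Hgw : 0 < g * Rpower t (- q)) by (apply Rmult_lt_0_compat; assumption).
  specialize (Hf xi ltac:(lra)).
  assert (Hs : 0 < sqrt t) by (apply sqrt_lt_R0; lra).
  apply Rle_trans with (sqrt t * (k * (g * Rpower t (- q)) ^ m)).
  - rewrite Rpow_mult_distr, <- (Rpower_pow m (Rpower t (- q))), Rpower_mult by exact Hw.
    rewrite <- Rpower_half by lra.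
    replace (Rpower t (1 / 2) * (k * (g ^ m * Rpower t (- q * INR m))))
      with (k * g ^ m * (Rpower t (1 / 2) * Rpower t (- q * INR m))) by ring.
    rewrite <- Rpower_plus. replace (1 / 2 + - q * INR m) with (1 / 2 - INR m * q) by ring.
    replace A with (k * g ^ m * (A / (k * g ^ m))) by (field; split; [apply pow_nonzero; lra|lra]).
    apply Rmult_le_compat_l; lra.
  - apply Rmult_le_compat_l; [lra|]. apply Rle_trans with (2 := Hf).
    apply Rmult_le_compat_l; [lra|]. apply pow_incr. lra.
Qed.

(** * The three types of roots *)

Lemma smooth_cont_halfline mu : smooth_on_halfline mu -> cont_halfline mu.
Proof.
  intros [D [E HD]]. apply (cont_halfline_ext (D O)); [exact E|].
  apply continuous_cont_halfline. intros t. apply derivable_continuous_pt.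
  exists (D 1%nat t). apply HD.
Qed.

Lemma cbrt_neg x : x < 0 -> cbrt x < 0.
Proof.
  intros Hx. unfold cbrt. destruct (Rcase_abs x) as [_|H]; [|lra].
  pose proof (exp_pos (1 / 3 * ln (- x))) as P. unfold Rpower. lra.
Qed.

Theorem theorem3 :
  forall (lam nu : R) (mu : R -> R) (muc : nat -> R) (sigma : R),
    0 < lam -> 0 <= nu < PI ->
    smooth_on_halfline mu -> mu_expansion mu muc ->
    Pf sigma (muc O * sqrt lam) nu = 0 ->
    (Pf1 sigma (muc O * sqrt lam) nu < 0 ->
       forall rs ps, MS_sol lam nu mu None rs ps ->
         typeE1 lam (muc O * sqrt lam) nu sigma rs ps ->
         lyap_unstable lam nu mu rs ps) /\
    (Pf1 sigma (muc O * sqrt lam) nu = 0 -> Pf2 sigma (muc O * sqrt lam) nu < 0 ->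
       forall rs ps, MS_sol lam nu mu None rs ps ->
         typeE2_plus lam (muc O * sqrt lam) nu sigma rs ps ->
         lyap_unstable lam nu mu rs ps) /\
    (Pf1 sigma (muc O * sqrt lam) nu = 0 -> Pf2 sigma (muc O * sqrt lam) nu = 0 ->
       Pf3 sigma (muc O * sqrt lam) nu < 0 ->
       forall rs ps, MS_sol lam nu mu None rs ps ->
         typeE3 lam (muc O * sqrt lam) nu sigma rs ps ->
         lyap_unstable lam nu mu rs ps).
Proof.
  intros lam nu mu muc sigma Hlam _ Hsm Hmu _.
  pose proof (smooth_cont_halfline mu Hsm) as Cmu.
  set (de := muc O * sqrt lam).
  assert (Hl : 0 < sqrt lam) by (apply sqrt_lt_R0, Hlam).
  split; [|split].
  - intros P1 rs ps Ss [rc [pc [_ [_ [Hrs Hps]]]]].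
    destruct (continuity_pt_neg_near (fun u => Pf1 u de nu) sigma) as [k [e [Hk [He H]]]];
      [apply derivable_continuous_pt; exists (Pf2 sigma de nu); apply Pf1_derive|exact P1|].
    apply (unstable_of_slope lam nu mu muc rs ps rc (1 / 2) (e / 3)); auto; try lra.
    intros A.
    destruct (asymp_vanishing _ _ _ _ (e / 3) Hps ltac:(lra) ltac:(lra)) as [M1 [HM1 H1]].
    destruct (Rpower_unbounded (1 / 2) (A / k) ltac:(lra)) as [M2 [HM2 H2]].
    exists (Rmax M1 M2). intros t xi Ht Hxi. fold de.
    pose proof (Rmax_l M1 M2). pose proof (Rmax_r M1 M2).
    specialize (H1 t ltac:(lra)). specialize (H2 t ltac:(lra)). apply Rabs_le_inv in H1.
    rewrite Rpower_half in H2 by lra.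
    specialize (H xi ltac:(apply Rabs_def1; lra)).
    replace A with (A / k * k) by (field; lra).
    assert (Hs : 0 < sqrt t) by (apply sqrt_lt_R0; lra).
    apply Rle_trans with (sqrt t * k); [apply Rmult_le_compat_r; lra|].
    apply Rmult_le_compat_l; lra.
  (* [Pf1] has a simple zero at [sigma], and [psi_1 = phi > 0] places [ps] above it by the order
     [t^(-1/4)]; so [- sqrt t * Pf1] grows like [t^(1/4)]. *)
  - intros P1 P2 rs ps Ss [rc [pc [_ [Hpc [Hrs Hps]]]]].
    destruct (continuity_pt_neg_near (fun u => Pf2 u de nu) sigma) as [k [e [Hk [He H]]]];
      [apply derivable_continuous_pt; exists (Pf3 sigma de nu); apply Pf2_derive|exact P2|].
    apply (unstable_of_slope lam nu mu muc rs ps rc (1 / 4) (e / 3)); auto; try lra.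
    apply (slope_of_degenerate_root (fun u => Pf1 u de nu) ps pc sigma (1 / 4) 1 k e);
      auto; try lra.
    + rewrite Hpc. apply sqrt_lt_R0. fold de in P2 |- *.
      replace (- sqrt lam / Pf2 sigma de nu) with (sqrt lam / - Pf2 sigma de nu) by (field; lra).
      apply Rdiv_lt_0_compat; lra.
    + simpl; lra.
    + intros xi Hxi.
      destruct (MVT_cor2 (fun u => Pf1 u de nu) (fun u => Pf2 u de nu) sigma xi)
        as [c [E Hc]]; [lra|intros; apply Pf1_derive|].
      specialize (H c ltac:(apply Rabs_def1; lra)). fold de in P1. nra.
  (* [Pf1] has a double zero, and [Pf3 < 0] makes [- chi] positive, so [ps] lies above [sigma] by
     the order [t^(-1/6)] and [- sqrt t * Pf1] grows like [t^(1/2 - 1/3)]. *)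
  - intros P1 P2 P3 rs ps Ss [rc [pc [_ [Hpc [Hrs Hps]]]]]. fold de in P1, P2, P3.
    destruct (continuity_pt_neg_near (fun u => Pf3 u de nu) sigma) as [k [e [Hk [He H]]]];
      [apply Pf3_continuous|exact P3|].
    apply (unstable_of_slope lam nu mu muc rs ps rc (1 / 6) (e / 3)); auto; try lra.
    apply (slope_of_degenerate_root (fun u => Pf1 u de nu) ps pc sigma (1 / 6) 2 (k / 2) e);
      auto; try lra.
    + rewrite Hpc. fold de. apply Ropp_0_gt_lt_contravar, cbrt_neg.
      assert (0 < 3 * sqrt lam / - Pf3 sigma de nu) by (apply Rdiv_lt_0_compat; lra).
      replace (3 * sqrt lam / Pf3 sigma de nu) with (- (3 * sqrt lam / - Pf3 sigma de nu))
        by (field; lra). lra.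
    + simpl; lra.
    + assert (HP2 : forall u, sigma < u < sigma + e -> Pf2 u de nu <= - (k * (u - sigma))).
      { intros u Hu.
        destruct (MVT_cor2 (fun u => Pf2 u de nu) (fun u => Pf3 u de nu) sigma u)
          as [c [E Hc]]; [lra|intros; apply Pf2_derive|].
        specialize (H c ltac:(apply Rabs_def1; lra)). nra. }
      intros xi Hxi.
      (* Adding [k / 2 * (u - sigma)^2] gives a function that vanishes at [sigma] and has derivative
         [Pf2 + k (u - sigma) <= 0] by [HP2], so it is nonpositive to the right of [sigma]. *)
      destruct (MVT_cor2 (fun u => Pf1 u de nu + k / 2 * (u - sigma) ^ 2)
                  (fun u => Pf2 u de nu + k / 2 * (2 * (u - sigma) * 1)) sigma xi)
        as [c [E Hc]]; [lra| |].
      { intros u _.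
        apply (derivable_pt_lim_plus (fun u => Pf1 u de nu) (fun u => k / 2 * (u - sigma) ^ 2));
          [apply Pf1_derive|].
        apply (derivable_pt_lim_scal (fun u => (u - sigma) ^ 2)).
        apply (derivable_pt_lim_comp (fun u => u - sigma) (fun u => u ^ 2)).
        - pose proof (derivable_pt_lim_minus _ _ _ _ _ (derivable_pt_lim_id u)
                        (derivable_pt_lim_const sigma u)) as L.
          rewrite Rminus_0_r in L. exact L.
        - replace (2 * (u - sigma)) with (INR 2 * (u - sigma) ^ 1) by (simpl; ring).
          apply (derivable_pt_lim_pow (u - sigma) 2). }
      specialize (HP2 c ltac:(lra)).
      assert ((Pf2 c de nu + k / 2 * (2 * (c - sigma) * 1)) * (xi - sigma) <= 0) by nra.
      rewrite P1 in E. simpl in E |- *. nra.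
Qed.
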